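(* Let $n\ge1$, $k\ge2$, and let $P(\lambda)=\sum_{j=0}^k\lambda^jA_j$ be a $(\star,\epsilon_1,\epsilon_2)$-structured matrix polynomial over $\mathbb{K}$ with $A_k$ nonsingular, of one of the types (1)–(4) below. Let $(X,J)\in\mathbb{K}^{n\times kn}\times\mathbb{K}^{kn\times kn}$ be a standard pair of $P(\lambda)$ with $X=[X_1,\ldots,X_s]$ and $J=\mathrm{diag}(J_1,\ldots,J_s)$, where the $J_j$ have the form specified in the context for the type of $P$. Then there is a nonsingular $\Gamma\in\mathcal{S}_{(J,\star,\epsilon_1,\epsilon_2)}$ with $XJ^r\Gamma X^\star=0$ for $r=0,\ldots,k-2$, $$A_k=(XJ^{k-1}\Gamma X^{\star})^{-1},\qquad A_j=-\sum_{i=j+1}^kA_iXJ^{k-j+i-1}\Gamma X^{\star}A_k\quad(j=0,\ldots,k-1),$$ and $\Gamma=\mathrm{diag}(\Gamma_{11},\ldots,\Gamma_{ss})$ (partitioned conformably with $J$) with the following structure. (1) $T$-skew-symmetric ($\mathbb{K}=\mathbb{R}$): $\Gamma_{jj}=\begin{bmatrix} U_{jj} & W_{jj} \\ W_{jj} & -U_{jj} \end{bmatrix}$ for $j=1,\ldots,r$ and $\Gamma_{jj}=U_{jj}$ for $j=r+1,\ldots,s$, where $U_{jj},W_{jj}\in\mathbb{R}^{n_j\times n_j}$ are skew-symmetric and of upper triangular Hankel blocks form. (2) $T$-odd ($\mathbb{K}=\mathbb{R}$): $\Gamma_{jj}=\begin{bmatrix} 0 & \tilde U_j \\ \tilde U_j^T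 & 0 \end{bmatrix}$ with $\tilde U_j=\begin{bmatrix} \tilde U_{j1} & \tilde U_{j2} \\ \tilde U_{j2} & -\tilde U_{j1} \end{bmatrix}\in\mathbb{R}^{2n_j\times2n_j}$ for $j=1,\ldots,r_1$; $\Gamma_{jj}=\begin{bmatrix} \tilde W_{j1} & \tilde W_{j2} \\ -\tilde W_{j2} & \tilde W_{j1} \end{bmatrix}\in\mathbb{R}^{2n_j\times2n_j}$ for $j=r_1+1,\ldots,r_2$; $\Gamma_{jj}=\begin{bmatrix} 0 & \tilde V_{j2} \\ \tilde V_{j2}^T & 0 \end{bmatrix}\in\mathbb{R}^{2n_j\times2n_j}$ for $j=r_2+1,\ldots,s-1$; where $\tilde U_{j1},\tilde U_{j2},\tilde V_{j2}$ are of upper triangular skew-Hankel blocks form, $\tilde W_{j1}$ and $\Gamma_{ss}$ are symmetric and of upper triangular skew-Hankel blocks form, and $\tilde W_{j2}$ is skew-symmetric and of upper triangular skew-Hankel blocks form. (3) $\star=H$, $\epsilon_1=\epsilon_2$ ($\mathbb{K}=\mathbb{C}$): $\Gamma_{jj}=\begin{bmatrix} 0 & W_j \\ \rho W_j^H & 0 \end{bmatrix}$ for $j=1,\ldots,r$ and $\Gamma_{jj}=W_j$ for $j=r+1,\ldots,s$, where $W_j\in\mathbb{C}^{n_j\times n_j}$ $(j\le r)$ are of upper triangular Hankel blocks form. If $P$ is $H$-Hermitian, then $\rho=1$ and $W_j$ $(j>r)$ are Hermitian of upper triangular Hankel blocks form; if $P$ is $H$-skew-Hermitian, then $\rho=-1$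 and $W_j$ $(j>r)$ are skew-Hermitian of upper triangular Hankel blocks form. (4) $\star=H$, $\epsilon_1\ne\epsilon_2$ ($\mathbb{K}=\mathbb{C}$): $\Gamma_{jj}=\begin{bmatrix} 0 & V_j \\ \rho V_j^H & 0 \end{bmatrix}$ for $j=1,\ldots,r$ and $\Gamma_{jj}=V_j$ for $j=r+1,\ldots,s$, where $V_j\in\mathbb{C}^{n_j\times n_j}$ $(j\le r)$ are of upper triangular skew-Hankel blocks form. If $P$ is $H$-odd, then $\rho=1$ and $V_j$ $(j>r)$ are Hermitian of upper triangular skew-Hankel blocks form; if $P$ is $H$-even, then $\rho=-1$ and $V_j$ $(j>r)$ are skew-Hermitian of upper triangular skew-Hankel blocks form.
   Context: $A^\star$ is the conjugate transpose ($\star=H$) or transpose ($\star=T$). $P(\lambda)=\sum_{j=0}^k\lambda^jA_j$, $A_j\in\mathbb{K}^{n\times n}$, is $(\star,\epsilon_1,\epsilon_2)$-structured ($\epsilon_1,\epsilon_2\in\{1,-1\}$) if $A_j^\star=\epsilon_1A_j$ for even $j$ and $A_j^\star=\epsilon_2A_j$ for odd $j$. Names of $(\star,\epsilon_1,\epsilon_2)$: $T$-skew-symmetric $(T,-1,-1)$; $T$-odd $(T,-1,1)$; $H$-Hermitian $(H,1,1)$; $H$-skew-Hermitian $(H,-1,-1)$; $H$-even $(H,1,-1)$; $H$-odd $(H,-1,1)$. $(X,J)$ is a standard pair of $P$ if the matrix $X_L$ obtained by stacking $X,XJ,\ldots,XJ^{k-1}$ is nonsingular and $\sum_{i=0}^kA_iXJ^i=0$.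 With $\epsilon=\epsilon_1\epsilon_2$, $\mathcal{S}_{(\Phi,\star,\epsilon_1,\epsilon_2)}=\{S: S^\star=\epsilon_2S,\ S\Phi^\star=\epsilon\,\Phi S\}$. Form of the blocks $J_j$. In all cases the spectra of $J_1,\ldots,J_s$ are pairwise disjoint, and $N_j=\mathrm{diag}(N_1^{(j)},\ldots,N_{m_j}^{(j)})$ is $n_j\times n_j$, where $N_t^{(j)}$ is the $n_t^{(j)}\times n_t^{(j)}$ nilpotent Jordan block (ones on the superdiagonal, zeros elsewhere). Type (1): for $j\le r$, $J_j=\begin{bmatrix} \alpha_jI+N_j & \beta_jI \\ -\beta_jI & \alpha_jI+N_j \end{bmatrix}$ with $\alpha_j,\beta_j\in\mathbb{R}$, $\beta_j\neq0$; for $r<j\le s$, $J_j=\alpha_jI+N_j$, $\alpha_j\in\mathbb{R}$. Type (2): for $j\le r_1$, $J_j=\mathrm{diag}\left(\begin{bmatrix} \alpha_jI+N_j & \beta_jI \\ -\beta_jI & \alpha_jI+N_j \end{bmatrix},\begin{bmatrix} -\alpha_jI+N_j & -\beta_jI \\ \beta_jI & -\alpha_jI+N_j \end{bmatrix}\right)$ with $\alpha_j,\beta_j$ real and nonzero; for $r_1<j\le r_2$, $J_j=\begin{bmatrix} N_j & \beta_jI \\ -\beta_jI & N_j \end{bmatrix}$, $\beta_j$ real nonzero; for $r_2<j\le s-1$, $J_j=\mathrm{diag}(\alpha_jI+N_j,-\alpha_jI+N_j)$, $\alpha_j$ real nonzero; $J_s=N_s$ (absent if $0$ is not an eigenvalue).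 Type (3): for $j\le r$, $J_j=\mathrm{diag}(\lambda_jI+N_j,\bar\lambda_jI+N_j)$, $\lambda_j\in\mathbb{C}\setminus\mathbb{R}$; for $r<j\le s$, $J_j=\lambda_jI+N_j$, $\lambda_j\in\mathbb{R}$. Type (4): for $j\le r$, $J_j=\mathrm{diag}(\lambda_jI+N_j,-\bar\lambda_jI+N_j)$, $\lambda_j\in\mathbb{C}\setminus\mathrm{i}\mathbb{R}$; for $r<j\le s$, $J_j=\lambda_jI+N_j$, $\lambda_j\in\mathrm{i}\mathbb{R}$. (All $I=I_{n_j}$.) An $m\times n$ matrix $H=(h_{ij})$ is Hankel if $h_{ij}=\eta_{i+j-1}$ for some scalars $\eta_1,\ldots,\eta_{m+n-1}$, and upper triangular Hankel if moreover $\eta_t=0$ for all $t>\min\{m,n\}$. With $D_m=\mathrm{diag}(1,-1,\ldots,(-1)^{m-1})$, $H$ is (upper triangular) skew-Hankel if $D_mH$ is (upper triangular) Hankel. An $n_j\times n_j$ matrix $Z$ is of upper triangular Hankel (resp. skew-Hankel) blocks form if, partitioned as $Z=[Z_{it}]_{m_j\times m_j}$ with $Z_{it}$ of size $n_i^{(j)}\times n_t^{(j)}$, every $Z_{it}$ is upper triangular Hankel (resp. skew-Hankel). *)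

(* Defs.v *)
From HB Require Import structures.
From mathcomp Require Import all_boot all_order all_algebra.
From mathcomp Require Import reals.
From mathcomp Require Import complex.

Set Implicit Arguments.
Unset Strict Implicit.
Unset Printing Implicit Defensive.

Import Order.TTheory GRing.Theory Num.Theory.
Local Open Scope ring_scope.
Local Open Scope sesquilinear_scope.

(* The operation [star] is [@trmx R] over a real field R and [@ctrmx R] over
   R[i]. *)
Definition star_op (K : Type) := forall p q, 'M[K]_(p, q) -> 'M[K]_(q, p).

Definition ctrmx (R : realType) : star_op R[i] := fun p q M => M ^t*.

(* A matrix polynomial of grade k is given by the family A of its coefficients;
   only A 0, ..., A k are used. *)
Definition structured (K : fieldType) (star : star_op K) (eps1 eps2 : K)
    (n k : nat) (A : nat -> 'M[K]_n) : Prop :=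
  forall j, (j <= k)%N ->
    star n n (A j) = (if odd j then eps2 else eps1) *: A j.

Definition T_skew_symmetric (R : realType) n k (A : nat -> 'M[R]_n) :=
  structured (@trmx R) (-1) (-1) k A.
Definition T_odd (R : realType) n k (A : nat -> 'M[R]_n) :=
  structured (@trmx R) (-1) 1 k A.
Definition H_hermitian (R : realType) n k (A : nat -> 'M[R[i]]_n) :=
  structured (@ctrmx R) 1 1 k A.
Definition H_skew_hermitian (R : realType) n k (A : nat -> 'M[R[i]]_n) :=
  structured (@ctrmx R) (-1) (-1) k A.
Definition H_even (R : realType) n k (A : nat -> 'M[R[i]]_n) :=
  structured (@ctrmx R) 1 (-1) k A.
Definition H_odd (R : realType) n k (A : nat -> 'M[R[i]]_n) :=
  structured (@ctrmx R) (-1) 1 k A.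

(* The size N of J is typically a sum of block sizes.  The equation e forces
   N = k * n and makes the stacked matrix X_L square. *)
Definition standard_pair (K : fieldType) (n k N : nat) (A : nat -> 'M[K]_n)
    (X : 'M[K]_(n, N)) (J : 'M[K]_N) : Prop :=
  (exists e : (\sum_(i < k) n)%N = N,
     castmx (e, erefl N) (\mxcol_(i < k) (X *m J ^+ i)) \in unitmx) /\
  \sum_(0 <= i < k.+1) A i *m X *m J ^+ i = 0.

Definition in_S (K : fieldType) (star : star_op K) (eps1 eps2 : K) (N : nat)
    (Phi S : 'M[K]_N) : Prop :=
  star N N S = eps2 *: S /\
  S *m star N N Phi = (eps1 * eps2) *: (Phi *m S).

Definition represents (K : fieldType) (star : star_op K) (n k N : nat)
    (A : nat -> 'M[K]_n) (X : 'M[K]_(n, N)) (J Gamma : 'M[K]_N) : Prop :=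
  [/\ forall i, (i <= k - 2)%N -> X *m J ^+ i *m Gamma *m star n N X = 0,
      X *m J ^+ (k - 1) *m Gamma *m star n N X \in unitmx,
      A k = invmx (X *m J ^+ (k - 1) *m Gamma *m star n N X)
    & forall j, (j < k)%N ->
        A j = - \sum_(j.+1 <= i < k.+1)
                  A i *m (X *m J ^+ (k - j + i - 1) *m Gamma *m star n N X)
                      *m A k].

(* The structure constants are numbered from 1 and rows and columns from 0. *)
Definition ut_hankel (K : fieldType) (p q : nat) (H : 'M[K]_(p, q)) : Prop :=
  exists eta : nat -> K,
    (forall i j, H i j = eta (i + j).+1) /\
    (forall t, (minn p q < t)%N -> eta t = 0).

Definition altmx (K : fieldType) (p : nat) : 'M[K]_p :=
  diag_mx (\row_i (-1) ^+ i).

Definition ut_skew_hankel (K : fieldType) (p q : nat) (H : 'M[K]_(p, q)) :=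
  ut_hankel (altmx K p *m H).

Definition ut_hankel_blocks (K : fieldType) (m : nat) (d : 'I_m -> nat)
    (Z : 'M[K]_(\sum_t d t)) : Prop :=
  forall i t, ut_hankel (submxblock Z i t).

Definition ut_skew_hankel_blocks (K : fieldType) (m : nat) (d : 'I_m -> nat)
    (Z : 'M[K]_(\sum_t d t)) : Prop :=
  forall i t, ut_skew_hankel (submxblock Z i t).

Definition jordan0 (K : fieldType) (p : nat) : 'M[K]_p :=
  \matrix_(i, j) (i.+1 == j)%:R.

Definition nilp (K : fieldType) (m : nat) (d : 'I_m -> nat)
    : 'M[K]_(\sum_t d t) :=
  \mxdiag_t jordan0 K (d t).

Definition diag2 (K : fieldType) (p q : nat) (A : 'M[K]_p) (B : 'M[K]_q)
    : 'M[K]_(p + q) := block_mx A 0 0 B.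

Definition jordanblk (K : fieldType) (m : nat) (d : 'I_m -> nat) (a : K)
    : 'M[K]_(\sum_t d t) := a%:M + nilp K d.

Definition real_jordanblk (K : fieldType) (m : nat) (d : 'I_m -> nat) (a b : K)
    : 'M[K]_(\sum_t d t + \sum_t d t) :=
  block_mx (jordanblk d a) b%:M (- b)%:M (jordanblk d a).

(* Choice between blocks of different sizes according to the position of the
   block in the block diagonal matrix. *)
Definition sel (K : fieldType) (b : bool) (p q : nat) (A : 'M[K]_p)
    (B : 'M[K]_q) : 'M[K]_(if b then p else q) :=
  if b return 'M[K]_(if b then p else q) then A else B.

Definition dim1 (r j nj : nat) : nat := if (j < r)%N then (nj + nj)%N else nj.

Definition dim2 (s r1 r2 j nj : nat) : nat :=
  if (j < r1)%N then ((nj + nj) + (nj + nj))%N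
  else if (j < r2)%N then (nj + nj)%N
  else if (j < s.-1)%N then (nj + nj)%N else nj.

(* In what follows block j of J, for j = 0, ..., s - 1, is built from the
   nilpotent matrix [nilp K (d j)], which has m j Jordan blocks, of sizes
   d j 0, ..., d j (m j - 1). *)
Definition bsize (s : nat) (m : 'I_s -> nat) (d : forall j, 'I_(m j) -> nat)
    (j : 'I_s) : nat := (\sum_t d j t)%N.

Definition J1 (R : realType) (s r : nat) (m : 'I_s -> nat)
    (d : forall j, 'I_(m j) -> nat) (alpha beta : 'I_s -> R) (j : 'I_s)
    : 'M[R]_(dim1 r j (bsize d j)) :=
  sel (j < r)%N (real_jordanblk (d j) (alpha j) (beta j))
                (jordanblk (d j) (alpha j)).

Definition J2 (R : realType) (s r1 r2 : nat) (m : 'I_s -> nat)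
    (d : forall j, 'I_(m j) -> nat) (alpha beta : 'I_s -> R) (j : 'I_s)
    : 'M[R]_(dim2 s r1 r2 j (bsize d j)) :=
  sel (j < r1)%N (diag2 (real_jordanblk (d j) (alpha j) (beta j))
                        (real_jordanblk (d j) (- alpha j) (- beta j)))
 (sel (j < r2)%N (real_jordanblk (d j) 0 (beta j))
 (sel (j < s.-1)%N (diag2 (jordanblk (d j) (alpha j))
                          (jordanblk (d j) (- alpha j)))
                   (nilp R (d j)))).

Definition J3 (R : realType) (s r : nat) (m : 'I_s -> nat)
    (d : forall j, 'I_(m j) -> nat) (lambda : 'I_s -> R[i]) (j : 'I_s)
    : 'M[R[i]]_(dim1 r j (bsize d j)) :=
  sel (j < r)%N (diag2 (jordanblk (d j) (lambda j))
                       (jordanblk (d j) (lambda j)^*))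
                (jordanblk (d j) (lambda j)).

Definition J4 (R : realType) (s r : nat) (m : 'I_s -> nat)
    (d : forall j, 'I_(m j) -> nat) (lambda : 'I_s -> R[i]) (j : 'I_s)
    : 'M[R[i]]_(dim1 r j (bsize d j)) :=
  sel (j < r)%N (diag2 (jordanblk (d j) (lambda j))
                       (jordanblk (d j) (- (lambda j)^*)))
                (jordanblk (d j) (lambda j)).

(* The spectrum of a real matrix is the set of its complex eigenvalues. *)
Definition disjoint_spectra (C : fieldType) (s : nat) (p : 'I_s -> nat)
    (B : forall j, 'M[C]_(p j)) : Prop :=
  forall i j, i != j -> forall z : C, ~~ (eigenvalue (B i) z && eigenvalue (B j) z).

Definition disjoint_spectra_real (R : realType) (s : nat) (p : 'I_s -> nat)
    (B : forall j, 'M[R]_(p j)) : Prop :=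
  disjoint_spectra (fun j => map_mx (real_complex R) (B j)).

Definition Gamma1 (R : realType) (s r : nat) (m : 'I_s -> nat)
    (d : forall j, 'I_(m j) -> nat) (U W : forall j, 'M[R]_(bsize d j))
    (j : 'I_s) : 'M[R]_(dim1 r j (bsize d j)) :=
  sel (j < r)%N (block_mx (U j) (W j) (W j) (- U j)) (U j).

(* G is relevant only at the last index. *)
Definition Gamma2 (R : realType) (s r1 r2 : nat) (m : 'I_s -> nat)
    (d : forall j, 'I_(m j) -> nat)
    (U1 U2 W1 W2 V G : forall j, 'M[R]_(bsize d j))
    (j : 'I_s) : 'M[R]_(dim2 s r1 r2 j (bsize d j)) :=
  let U := block_mx (U1 j) (U2 j) (U2 j) (- U1 j) in
  sel (j < r1)%N (block_mx 0 U U^T 0)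
 (sel (j < r2)%N (block_mx (W1 j) (W2 j) (- W2 j) (W1 j))
 (sel (j < s.-1)%N (block_mx 0 (V j) (V j)^T 0)
                   (G j))).

Definition Gamma34 (R : realType) (s r : nat) (m : 'I_s -> nat)
    (d : forall j, 'I_(m j) -> nat) (rho : R[i])
    (W : forall j, 'M[R[i]]_(bsize d j))
    (j : 'I_s) : 'M[R[i]]_(dim1 r j (bsize d j)) :=
  sel (j < r)%N (block_mx 0 (W j) (rho *: (W j) ^t*) 0) (W j).

(* Main.v *)
(** Write [eps = eps1 * eps2] and let [Theta] be the sum over [i + j < k] of
    [eps^i (J^star)^i X^star A_(i+j+1) X J^j].  It inherits
    [Theta^star = eps2 Theta] from the structure of the coefficients, and
    [J^star Theta = eps Theta J] because the difference telescopes along the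
    antidiagonals to terms killed by [sum_i A_i X J^i = 0].  It is invertible
    because [X_L] and the block anti-triangular matrix [(A_(i+j+1))] are, and
    [Gamma = Theta^-1] has the required moments [X J^r Gamma X^star].

    The relation [J Gamma = Gamma (eps J^star)] together with the disjointness
    of the spectra makes [Gamma] block diagonal, each [J_j] being similar to
    [eps J_j^star].  Inside a diagonal block, shifting and separating conjugate
    eigenvalues leaves equations [N Z = Z N^T] or [N Z = - Z N^T], which say
    exactly that [Z] is upper triangular Hankel or skew-Hankel. *)

Require Import Defs.
From mathcomp Require Import all_boot all_order all_algebra.
From mathcomp Require Import boolp reals.
From mathcomp Require Import ring zify.
From mathcomp Require Import complex.

Set Implicit Arguments.
Unset Strict Implicit.
Unset Printing Implicit Defensive.

Import Order.TTheory GRing.Theory Num.Theory.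
Local Open Scope ring_scope.
Local Open Scope sesquilinear_scope.

(** * Construction of [Gamma] from the coefficients and the standard pair *)

Section Linearization.

Lemma sum_triangle (V : zmodType) (f : nat -> nat -> V) k :
  \sum_(0 <= i < k) \sum_(0 <= j < k - i) f i j =
  \sum_(0 <= t < k) \sum_(0 <= i < t.+1) f i (t - i)%N.
Proof.
elim: k => [|k IHk]; first by rewrite !big_geq.
rewrite [RHS]big_nat_recr //= -IHk big_nat_recr //= subSnn big_nat1.
rewrite [X in _ = _ + X]big_nat_recr //= subnn addrA -big_split /=.
congr (_ + _); apply: eq_big_nat => i /andP[_ ltik].
by rewrite subSn ?(ltnW ltik) // big_nat_recr.
Qed.

Lemma sum_triangleC (V : zmodType) (f : nat -> nat -> V) k :
  \sum_(0 <= i < k) \sum_(0 <= j < k - i) f i j =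
  \sum_(0 <= j < k) \sum_(0 <= i < k - j) f i j.
Proof.
rewrite !sum_triangle; apply: eq_big_nat => t _.
rewrite big_nat_rev /= add0n; apply: eq_big_nat => i /andP[_ leit].
by rewrite subSS subKn.
Qed.

(** On each antidiagonal the differences telescope, so only the two endpoints on the axes
    survive. *)
Lemma sum_triangle_telescope (V : zmodType) (F : nat -> nat -> V) k :
  \sum_(0 <= i < k) \sum_(0 <= j < k - i) (F i.+1 j - F i j.+1) =
  \sum_(0 <= t < k) F t.+1 0%N - \sum_(0 <= t < k) F 0%N t.+1.
Proof.
rewrite sum_triangle -sumrB; apply: eq_big_nat => t _.
pose G i := F i (t.+1 - i)%N.
rewrite (eq_big_nat _ _ (F2 := fun i => G i.+1 - G i)).
  by rewrite telescope_sumr // /G subnn subn0.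
by move=> i /andP[_ leit]; rewrite /G subSS subSn.
Qed.

(** Taking for [v] the transposed kernel matrix of [M^T] tests all kernel vectors at once. *)
Lemma unitmx_col_inj (K : fieldType) N (M : 'M[K]_N) :
  (forall v : 'M[K]_N, M *m v = 0 -> v = 0) -> M \in unitmx.
Proof.
move=> Minj; rewrite -unitmx_tr -row_free_unit -kermx_eq0 -trmx_eq0.
by apply/eqP/Minj; apply: trmx_inj; rewrite trmx_mul trmxK mulmx_ker trmx0.
Qed.

(** This lemma and the next are the two forms in which nonsingularity of the stacked matrix enters:
    injectivity on columns, and uniqueness of the coefficients in a combination of the blocks
    [X *m J ^+ i]. *)
Lemma standard_pair_col_inj (K : fieldType) n k N (A : nat -> 'M[K]_n)
    (X : 'M[K]_(n, N)) (J : 'M[K]_N) q (v : 'M[K]_(N, q)) :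
  standard_pair k A X J -> (forall i, (i < k)%N -> X *m J ^+ i *m v = 0) ->
  v = 0.
Proof.
(* Eliminating the size equation replaces [N] by the row count of the stacked matrix, and the cast
   becomes trivial. *)
case=> -[e]; case: N / e X J v => X J v; rewrite castmx_id => XLu _ v0.
have XLv0 : \mxcol_(i < k) (X *m J ^+ i) *m v = 0.
  by rewrite mxcol_mul -mxcol0; apply/eq_mxcolP => i; apply: v0.
by rewrite -(mulKmx XLu v) XLv0 mulmx0.
Qed.

Lemma standard_pair_row_free (K : fieldType) n k N (A : nat -> 'M[K]_n)
    (X : 'M[K]_(n, N)) (J : 'M[K]_N) q (C : nat -> 'M[K]_(q, n)) :
  standard_pair k A X J -> \sum_(0 <= i < k) C i *m (X *m J ^+ i) = 0 ->
  forall i, (i < k)%N -> C i = 0.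
Proof.
case=> -[e]; case: N / e X J => X J; rewrite castmx_id => XLu _.
rewrite big_mkord -(mul_mxrow_mxcol (fun i => C i)) => C0 i ltik.
have /eq_mxrowP/(_ (Ordinal ltik)) //=: \mxrow_(i < k) C i = \mxrow_(i < k) 0.
by rewrite mxrow0 -(mulmxK XLu (\mxrow_i C i)) C0 mul0mx.
Qed.

Variables (K : fieldType) (star : star_op K).
Hypothesis starD : forall p q (x y : 'M[K]_(p, q)),
  star (x + y) = star x + star y.
Hypothesis starM : forall p q r (x : 'M[K]_(p, q)) (y : 'M[K]_(q, r)),
  star (x *m y) = star y *m star x.
Hypothesis starK : forall p q (x : 'M[K]_(p, q)), star (star x) = x.

Lemma star0 p q : star (0 : 'M_(p, q)) = 0.
Proof. by apply: (addrI (star (0 : 'M_(p, q)))); rewrite -starD !addr0. Qed.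

Lemma starN p q (x : 'M[K]_(p, q)) : star (- x) = - star x.
Proof. by apply/eqP; rewrite -addr_eq0 -starD addNr star0. Qed.

Lemma star1 p : star (1%:M : 'M_p) = 1%:M.
Proof. by rewrite -[LHS]mulmx1 -{2}[1%:M]starK -starM mulmx1 starK. Qed.

Lemma star_sum p q a b (F : nat -> 'M[K]_(p, q)) :
  star (\sum_(a <= i < b) F i) = \sum_(a <= i < b) star (F i).
Proof. exact: (big_morph (@star p q) (@starD p q) (star0 p q)). Qed.

(** The operation may be conjugate-linear, so only signs are moved through it. *)
Lemma star_sign p q a (x : 'M[K]_(p, q)) :
  a = 1 \/ a = -1 -> star (a *: x) = a *: star x.
Proof. by case=> ->; rewrite ?scale1r // !scaleN1r starN. Qed.

Lemma sign_sqr (a : K) : a = 1 \/ a = -1 -> a * a = 1.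
Proof. by case=> ->; rewrite ?mulr1 // mulrNN mulr1. Qed.

Lemma sign_mul (a b : K) :
  a = 1 \/ a = -1 -> b = 1 \/ b = -1 -> a * b = 1 \/ a * b = -1.
Proof.
by move=> [->|->] [->|->]; rewrite ?mulrNN ?mulr1 ?mul1r; [left|right|right|left].
Qed.

Lemma sign_exp (a : K) i : a = 1 \/ a = -1 -> a ^+ i = 1 \/ a ^+ i = -1.
Proof.
move=> ha; elim: i => [|i IHi]; first by left; rewrite expr0.
by rewrite exprS; apply: sign_mul.
Qed.

Lemma sign_exp_odd (a : K) i : a = 1 \/ a = -1 -> a ^+ i = a ^+ odd i.
Proof.
move=> /sign_sqr aK; rewrite -{1}(odd_double_half i) exprD -mul2n exprM.
by rewrite expr2 aK expr1n mulr1.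
Qed.

Theorem structured_represents n k N (eps1 eps2 : K) (A : nat -> 'M[K]_n)
    (X : 'M[K]_(n, N)) (J : 'M[K]_N) :
  (2 <= k)%N -> eps1 = 1 \/ eps1 = -1 -> eps2 = 1 \/ eps2 = -1 ->
  structured (@star) eps1 eps2 k A -> A k \in unitmx -> standard_pair k A X J ->
  exists Gamma : 'M[K]_N, [/\ Gamma \in unitmx, in_S (@star) eps1 eps2 J Gamma
    & represents (@star) k A X J Gamma].
Proof.
move=> k_ge2 sgn1 sgn2 Astar Aku XJ; have [_ PX0] := XJ.
pose eps := eps1 * eps2.
have sgn : eps = 1 \/ eps = -1 by apply: sign_mul.
have epsK := sign_sqr sgn; have eps2K := sign_sqr sgn2.
have sgnX i := sign_exp i sgn.
(* An odd index [t.+1] has [eps ^+ t = 1]; an even one has [eps ^+ t = eps], and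
   [eps2 * eps = eps1]. *)
have starA t : (t < k)%N -> star (A t.+1) = (eps2 * eps ^+ t) *: A t.+1.
  move=> lttk; rewrite (Astar _ lttk) /=; congr (_ *: _).
  rewrite (sign_exp_odd t sgn).
  case: (odd t) => /=; last by rewrite mulr1.
  by rewrite expr1 mulrCA eps2K mulr1.
pose T j := X *m J ^+ j.
(* With the sign absorbed into [S], multiplication by [star J] shifts the index at the cost of a
   single factor [eps], independent of [i]. *)
pose S i := eps ^+ i *: star (T i).
have TS j : T j *m J = T j.+1 by rewrite /T exprSr mulmxA.
have JS i : star J *m S i = eps *: S i.+1.
  rewrite /S -scalemxAr -starM TS scalerA exprS mulrA epsK mul1r //.
have star_S i : star (S i) = eps ^+ i *: T i by rewrite star_sign // starK.
have star_T i : star (T i) = eps ^+ i *: S i.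
  by rewrite /S scalerA (sign_sqr (sgnX i)) scale1r.
have TE j : T j = X *m J ^+ j by [].
have S0E : S 0%N = star X by rewrite /S /T !expr0 scale1r mulmx1.
clearbody T S.
pose Th := \sum_(0 <= i < k) \sum_(0 <= j < k - i) S i *m A (i + j).+1 *m T j.
have starTh : star Th = eps2 *: Th.
  rewrite /Th star_sum sum_triangleC scaler_sumr; apply: eq_big_nat => i /andP[_ ik].
  rewrite star_sum scaler_sumr; apply: eq_big_nat => j /andP[_ jk].
  have -> : star (S i *m A (i + j).+1 *m T j) =
            star (T j) *m star (A (i + j).+1) *m star (S i).
    by rewrite (starM (_ *m _)) (starM (S i)) mulmxA.
  rewrite star_S star_T starA; last by rewrite -ltn_subRL.
  rewrite -!scalemxAl -!scalemxAr -!scalemxAl !scalerA [(j + i)%N]addnC.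
  congr (_ *: _); rewrite exprD.
  (* On the left each of [eps ^+ i] and [eps ^+ j] occurs twice; inserting their squares on the
     right balances the two sides. *)
  rewrite -[RHS]mulr1 -(sign_sqr (sgnX i)) -[RHS]mulr1 -(sign_sqr (sgnX j)).
  by rewrite !mulrA [_ * eps2]mulrC; ring.
have JTh : star J *m Th = eps *: (Th *m J).
  apply/eqP; rewrite -subr_eq0 /Th mulmx_sumr mulmx_suml scaler_sumr -sumrB.
  pose F i j := S i *m A (i + j)%N *m T j.
  transitivity (eps *: \sum_(0 <= i < k) \sum_(0 <= j < k - i)
                         (F i.+1 j - F i j.+1) == 0).
    congr (_ == 0); rewrite scaler_sumr; apply: eq_big_nat => i _.
    rewrite mulmx_sumr mulmx_suml !scaler_sumr -sumrB; apply: eq_big_nat => j _.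
    by rewrite !mulmxA JS -[_ *m T j *m J]mulmxA TS -!scalemxAl -scalerBr /F addnS.
  rewrite sum_triangle_telescope.
  (* The telescoped sums start at index 1. Completed by the common term [F 0 0] they both vanish,
     one by the equation of the pair and the other by its image under [star]; hence both boundary
     sums equal [- F 0 0] and cancel. *)
  have S0 : \sum_(0 <= t < k.+1) F t 0%N = 0.
    rewrite -[LHS]starK star_sum -[RHS]starK star0; congr star.
    rewrite -[RHS](mulmx0 _ (eps1 *: star (T 0%N))) -PX0 mulmx_sumr.
    apply: eq_big_nat => t /andP[_ lt_tk]; rewrite /F addn0.
    rewrite (starM (_ *m _)) (starM (S _)) star_S Astar //.
    rewrite -!(scalemxAl, scalemxAr) !scalerA -!mulmxA !TE.
    congr (_ *: _).
    have -> : eps ^+ t = eps ^+ odd t by apply: sign_exp_odd.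
    by case: (odd t); rewrite ?mulr1 // expr1 mulrCA eps2K mulr1.
  have T0 : \sum_(0 <= t < k.+1) F 0%N t = 0.
    rewrite -[RHS](mulmx0 _ (S 0%N)) -PX0 mulmx_sumr.
    by apply: eq_big_nat => t _; rewrite /F add0n TE !mulmxA.
  move: S0 T0; rewrite !big_nat_recl // => /eqP; rewrite addrC addr_eq0 => /eqP -> /eqP.
  by rewrite addrC addr_eq0 => /eqP ->; rewrite subrr scaler0 eqxx.
have Th_u : Th \in unitmx.
  apply: unitmx_col_inj => v Thv0.
  (* The [w i] are the blocks of the anti-triangular coefficient matrix applied to the stacked
     vector of the [T j *m v]. They vanish first, and the anti-triangular system is then solved for
     the [T j *m v]. *)
  pose w i := \sum_(0 <= j < k - i) A (i + j).+1 *m (T j *m v).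
  have Sw0 : \sum_(0 <= i < k) S i *m w i = 0.
    rewrite -[RHS]Thv0 mulmx_suml; apply: eq_big_nat => i _.
    by rewrite mulmx_suml mulmx_sumr; apply: eq_big_nat => j _; rewrite !mulmxA.
  have w0 i : (i < k)%N -> w i = 0.
    move=> lt_ik.
    (* Applying [star] turns the relation among the [S i] into one among the [X *m J ^+ i], where
       coefficients are unique. *)
    have wi0 : eps ^+ i *: star (w i) = 0.
      apply: (standard_pair_row_free (C := fun i => eps ^+ i *: star (w i)) XJ) => //.
      rewrite -[LHS]starK star_sum -[RHS]starK star0; congr star.
      rewrite -[RHS]Sw0; apply: eq_big_nat => l _.
      by rewrite -TE starM star_sign // starK star_T -!(scalemxAl, scalemxAr)
        scalerA (sign_sqr (sgnX l)) scale1r.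
    suff swi0 : star (w i) = 0 by rewrite -[w i]starK swi0 star0.
    by rewrite -[star _]scale1r -(sign_sqr (sgnX i)) -scalerA wi0 scaler0.
  apply: (standard_pair_col_inj XJ) => j; rewrite -TE.
  (* Row [k - j.+1] of the system involves only [T l *m v] with [l <= j], and its last coefficient
     is the invertible [A k]. *)
  elim/ltn_ind: j => j IHj lt_jk.
  have /w0 : (k - j.+1 < k)%N by rewrite ltn_subrL (leq_trans _ k_ge2).
  rewrite /w subKn // big_nat_recr //= big1_seq => [|l].
    rewrite add0r -addnS subnK // => /(congr1 (mulmx (invmx (A k)))).
    by rewrite mulKmx // mulmx0.
  rewrite mem_index_iota => /andP[_ lt_lj].
  by rewrite IHj ?mulmx0 // (ltn_trans lt_lj).
pose G := invmx Th.
have starG : star G = eps2 *: G.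
  have := congr1 (@star N N) (mulmxV Th_u); rewrite starM starTh.
  rewrite -scalemxAr star1 => /(congr1 (fun M => eps2 *: (M *m G))) /=.
  by rewrite -scalemxAl scalerA eps2K scale1r mulmxK // mul1mx.
have GJ : G *m star J = eps *: (J *m G).
  rewrite -[star J](mulmxK Th_u) JTh -scalemxAl -scalemxAr; congr (_ *: _).
  by rewrite !mulmxA mulVmx // mul1mx.
(* Expanding [T r = T r *m G *m Th] over the blocks [T j] and comparing coefficients gives [C j = 0]
   for every [j < k]. *)
have MA r : (r < k)%N -> T r *m G *m star X *m A k = (r == k.-1)%:R%:M.
  move=> lt_rk.
  pose C j := \sum_(0 <= i < k - j) T r *m G *m S i *m A (i + j).+1 - (r == j)%:R%:M.
  have C0 : \sum_(0 <= j < k) C j *m (X *m J ^+ j) = 0.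
    under eq_big_nat => j _ do rewrite mulmxBl.
    rewrite sumrB; apply/eqP; rewrite subr_eq0; apply/eqP.
    transitivity (T r).
      rewrite -[RHS](mulmxKV Th_u) -/G /Th sum_triangleC mulmx_sumr.
      apply: eq_big_nat => j _; rewrite mulmx_suml mulmx_sumr.
      by apply: eq_big_nat => i _; rewrite -TE !mulmxA.
    rewrite (bigD1_seq r) ?mem_index_iota ?iota_uniq //= eqxx mul1mx -TE.
    by rewrite big1 ?addr0 // => j /negPf; rewrite eq_sym => ->; rewrite raddf0 mul0mx.
  have := @standard_pair_row_free _ _ _ _ _ _ _ _ _ XJ C0 k.-1.
  rewrite prednK ?leqnn ?(leq_trans _ k_ge2) // => /(_ isT) /eqP.
  rewrite /C subr_eq0 => /eqP <-.
  (* For [j = k.-1] the inner sum has the single term [i = 0], where [S 0] is [star X]. *)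
  have -> : (k - k.-1 = 1)%N by case: (k) k_ge2 => // ? _; rewrite subSnn.
  by rewrite big_nat1 add0n prednK ?(leq_trans _ k_ge2) // S0E.
have k_gt0 : (0 < k)%N by apply: leq_trans k_ge2.
have M0 r : (r < k.-1)%N -> T r *m G *m star X = 0.
  move=> lt_rk; rewrite -(mulmxK Aku (_ *m star X)) MA.
    by rewrite (ltn_eqF lt_rk) raddf0 mul0mx.
  by rewrite (leq_trans lt_rk) ?leq_pred.
have M1 : T k.-1 *m G *m star X *m A k = 1%:M by rewrite MA ?eqxx // prednK.
have [M1u _] := mulmx1_unit M1.
have M1E : T k.-1 *m G *m star X = invmx (A k).
  by rewrite -[RHS]mul1mx -M1 mulmxK.
exists G; split; first by rewrite unitmx_inv.
  by [].
split.
- by move=> i le_ik; rewrite -TE M0 //; lia.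
- by rewrite subn1 -TE.
- by rewrite subn1 -TE M1E invmxK.
(* Since [T k.-1 *m G *m star X *m A k = 1], [A j] is the missing term [i = j] of the sum. The terms
   with [i < j] contain vanishing moments, so the sum extends down to 0 and factors through the
   equation of the pair. *)
move=> j lt_jk; apply/eqP; rewrite -addr_eq0; apply/eqP.
have -> : A j = A j *m (X *m J ^+ (k - j + j - 1) *m G *m star X) *m A k.
  by rewrite subnK 1?ltnW // subn1 -TE -mulmxA M1 mulmx1.
rewrite -big_ltn; last exact: leqW.
have TG i : A i *m X *m J ^+ i *m (J ^+ (k - j - 1) *m G *m star X *m A k) =
            A i *m (T (k - j + i - 1)%N *m G *m star X) *m A k.
  have -> : (k - j + i - 1 = i + (k - j - 1))%N by lia.
  by rewrite TE exprD -mulmxE !mulmxA.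
have -> : \sum_(j <= i < k.+1)
            A i *m (X *m J ^+ (k - j + i - 1) *m G *m star X) *m A k =
          \sum_(0 <= i < k.+1)
            A i *m X *m J ^+ i *m (J ^+ (k - j - 1) *m G *m star X *m A k).
  rewrite [RHS](@big_cat_nat _ _ _ j) //=; last by rewrite ltnW // ltnW.
  rewrite [X in _ = X + _]big_nat_cond [X in _ = X + _]big1 ?add0r.
    by apply: eq_big_nat => i _; rewrite TG TE.
  by move=> i /andP[/andP[_ lt_ij] _]; rewrite TG M0 ?mulmx0 ?mul0mx //; lia.
by rewrite -mulmx_suml PX0 mul0mx.
Qed.
End Linearization.

(** * Eigenvalues and Sylvester equations *)

Lemma eigenvalueE (K : fieldType) p (A : 'M[K]_p) z :
  eigenvalue A z = (A - z%:M \notin unitmx).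
Proof. by rewrite /eigenvalue /eigenspace kermx_eq0 row_free_unit. Qed.

Lemma eigenvalue_tr (K : fieldType) p (A : 'M[K]_p) z :
  eigenvalue A^T z = eigenvalue A z.
Proof. by rewrite !eigenvalueE -unitmx_tr linearB /= trmxK tr_scalar_mx. Qed.

Lemma eigenvalue_sim (K : fieldType) p (P A B : 'M[K]_p) z :
  P \in unitmx -> P *m A = B *m P -> eigenvalue A z = eigenvalue B z.
Proof.
move=> Pu PA; rewrite !eigenvalueE; congr (~~ _).
rewrite -[LHS]andTb -Pu -unitmx_mul mulmxBr PA scalar_mxC -mulmxBl.
by rewrite unitmx_mul Pu andbT.
Qed.

(** The relation passes to polynomials in [A] and [B]. For the characteristic polynomial of [B],
    Cayley-Hamilton kills the right side, while its value at [A] is a product of invertible factors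
    [A - z] over eigenvalues [z] of [B]. *)
Lemma sylvester_eq0 (C : closedFieldType) p q (A : 'M[C]_p) (B : 'M[C]_q)
    (Z : 'M[C]_(p, q)) :
  (forall z, ~~ (eigenvalue A z && eigenvalue B z)) -> A *m Z = Z *m B -> Z = 0.
Proof.
case: p A Z => [|p] A Z; first by rewrite [Z]flatmx0.
case: q B Z => [|q] B Z disj AZ; first by rewrite [Z]thinmx0.
have horner_AZ f : horner_mx A f *m Z = Z *m horner_mx B f.
  elim/poly_ind: f => [|f c IHf]; first by rewrite !rmorph0 mul0mx mulmx0.
  rewrite !rmorphD !rmorphM /= !horner_mx_X !horner_mx_C mulmxDl mulmxDr.
  rewrite scalar_mxC -[horner_mx A f * A]/(_ *m _) -[horner_mx B f * B]/(_ *m _).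
  by rewrite -mulmxA AZ !mulmxA IHf.
have := horner_AZ (char_poly B); rewrite Cayley_Hamilton mulmx0.
suff Au : horner_mx A (char_poly B) \in unitmx.
  by move=> /(congr1 (mulmx (invmx (horner_mx A (char_poly B))))); rewrite mulKmx ?mulmx0.
have [r def_r] := closed_field_poly_normal (char_poly B).
have r_eig z : z \in r -> eigenvalue B z.
  by move=> zr; rewrite eigenvalue_root_char def_r (monicP (char_poly_monic B))
    scale1r root_prod_XsubC.
rewrite def_r (monicP (char_poly_monic B)) scale1r rmorph_prod /=.
elim: r r_eig {def_r} => [|z r IHr] r_eig; first by rewrite big_nil unitmx1.
rewrite big_cons -mulmxE unitmx_mul IHr ?andbT => [|y yr]; last first.
  by apply: r_eig; rewrite inE yr orbT.
rewrite rmorphB /= horner_mx_X horner_mx_C.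
by have := disj z; rewrite r_eig ?mem_head // andbT eigenvalueE negbK.
Qed.

Lemma sylvester_eq0_real (R : realType) p q (A : 'M[R]_p) (B : 'M[R]_q)
    (Z : 'M[R]_(p, q)) :
  (forall z, ~~ (eigenvalue (map_mx (real_complex R) A) z &&
                 eigenvalue (map_mx (real_complex R) B) z)) ->
  A *m Z = Z *m B -> Z = 0.
Proof.
move=> disj AZ; apply/eqP; rewrite -(map_mx_eq0 (real_complex R)); apply/eqP.
by apply: sylvester_eq0 disj _; rewrite -!map_mxM AZ.
Qed.

(** Comparing blocks gives a separate Sylvester equation for each pair of indices; the second
    hypothesis removes the off-diagonal ones. *)
Lemma mxdiag_intertwine (K : fieldType) s (p : 'I_s -> nat)
    (B B' : forall j, 'M[K]_(p j)) (G : 'M[K]_(\sum_j p j)) :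
  (\mxdiag_j B j) *m G = G *m (\mxdiag_j B' j) ->
  (forall i j (Z : 'M_(p i, p j)), i != j -> B i *m Z = Z *m B' j -> Z = 0) ->
  G = \mxdiag_j submxblock G j j /\
  forall j, B j *m submxblock G j j = submxblock G j j *m B' j.
Proof.
move=> BG off.
have Gij i j : B i *m submxblock G i j = submxblock G i j *m B' j.
  move: BG; rewrite -{1 2}(submxblockK G) mul_mxdiag_mxblock mul_mxblock_mxdiag.
  by move=> /eq_mxblockP/(_ i j).
split=> //; rewrite -{1}(submxblockK G); apply/eq_mxblock => i j.
case: eqVneq => [eij|nij]; last exact: off nij (Gij i j).
by case: j / eij; rewrite conform_mx_id.
Qed.

Lemma mul_mxdiag (K : fieldType) s (p : 'I_s -> nat) (A B : forall j, 'M[K]_(p j)) :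
  (\mxdiag_j A j) *m (\mxdiag_j B j) = \mxdiag_j (A j *m B j).
Proof.
rewrite {2}/mxdiag mul_mxdiag_mxblock; apply/eq_mxblock => i j.
by case: eqVneq => [eij|]; [case: j / eij; rewrite !conform_mx_id | rewrite mulmx0].
Qed.

(** * Powers and spectra of the Jordan blocks *)

Lemma jordan0_exp (K : fieldType) p m :
  jordan0 K p ^+ m = \matrix_(i, j) ((i + m)%N == j)%:R.
Proof.
elim: m => [|m IHm]; apply/matrixP => i j.
  by rewrite expr0 !mxE addn0.
rewrite exprSr IHm -mulmxE !mxE.
have [lt_im_p|le_p_im] := ltnP (i + m) p.
  rewrite (bigD1 (Ordinal lt_im_p)) //= big1 => [|l ne_l].
    by rewrite !mxE eqxx mul1r addr0 addnS.
  rewrite !mxE (_ : _ == _ = false) ?mul0r //.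
  by apply: contraNF ne_l => /eqP eq_l; apply/eqP/val_inj.
rewrite big1 => [|l _].
  case: eqP => // eq_j; have := ltn_ord j; lia.
rewrite !mxE (_ : _ == _ = false) ?mul0r //.
by apply/eqP => eq_l; have := ltn_ord l; lia.
Qed.

Lemma nilp_nilpotent (K : fieldType) m (d : 'I_m -> nat) :
  exists e, Defs.nilp K d ^+ e = 0.
Proof.
(* The total size is a convenient exponent, at least as large as each block. *)
exists (\sum_t d t)%N.
have nilpX e : Defs.nilp K d ^+ e = \mxdiag_t (jordan0 K (d t) ^+ e).
  elim: e => [|e IHe].
    by under eq_mxdiag do rewrite expr0; rewrite mxdiagZ expr0.
  by rewrite exprS IHe -mulmxE mul_mxdiag; apply: eq_mxdiag => t; rewrite exprS.
rewrite nilpX -[RHS]mxdiag0; apply: eq_mxdiag => t; apply/matrixP => i j.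
rewrite jordan0_exp !mxE (_ : _ == _ = false) //; apply/eqP => eq_j.
have := ltn_ord j; have : (d t <= \sum_t d t)%N by rewrite (bigD1 t) //= leq_addr.
by lia.
Qed.

(** A left eigenvector [v] satisfies [v N^e = (z - a)^e v] for the nilpotent part [N], and some
    power of [N] is zero. *)
Lemma eigenvalue_jordanblk (K : fieldType) m (d : 'I_m -> nat) (a z : K) :
  eigenvalue (jordanblk d a) z -> z = a.
Proof.
case/eigenvalueP=> v; rewrite /jordanblk mulmxDr mul_mx_scalar => vJ v_neq0.
have vN : v *m Defs.nilp K d = (z - a) *: v by rewrite scalerBl -vJ addrAC subrr add0r.
have vNe e : v *m Defs.nilp K d ^+ e = (z - a) ^+ e *: v.
  elim: e => [|e IHe]; first by rewrite !expr0 mulmx1 scale1r.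
  by rewrite !exprS -mulmxE mulmxA vN -scalemxAl IHe scalerA.
have [e Ne0] := nilp_nilpotent K d.
have /esym/eqP := vNe e; rewrite Ne0 mulmx0 scaler_eq0 (negPf v_neq0) orbF.
by rewrite expf_eq0 subr_eq0 => /andP[_ /eqP].
Qed.

(** If [(l, r)] is a left eigenvector and [c] is a square root of -1, then [l + c r] is zero or a
    left eigenvector of the Jordan matrix at [a + c b] for the same [z]. The two choices of [c]
    cannot both give zero. *)
Lemma eigenvalue_real_jordanblk (C : numClosedFieldType) m (d : 'I_m -> nat)
    (a b z : C) :
  eigenvalue (real_jordanblk d a b) z -> z = a + 'i * b \/ z = a - 'i * b.
Proof.
case/eigenvalueP=> v; rewrite -[v]hsubmxK; set l := lsubmx v; set r := rsubmx v.
rewrite /real_jordanblk mul_row_block scale_row_mx => /eq_row_mx[lJ rJ] v_neq0.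
rewrite !mul_mx_scalar in lJ rJ.
have eig w c : c * c = -1 -> w = l + c *: r -> w = 0 \/ z = a + c * b.
  move=> c2 def_w; have [->|w_neq0] := eqVneq w 0; [by left | right].
  suff: eigenvalue (jordanblk d (a + c * b)) z by move/eigenvalue_jordanblk.
  apply/eigenvalueP; exists w => //.
  have -> : jordanblk d (a + c * b) = jordanblk d a + (c * b)%:M.
    by rewrite /jordanblk raddfD /= addrAC.
  transitivity (z *: l + c *: (z *: r)); last first.
    by rewrite def_w scalerDr !scalerA mulrC.
  rewrite -lJ -rJ mulmxDr mul_mx_scalar def_w mulmxDl -!scalemxAl.
  rewrite !scalerDr !scalerA (mulrAC c b c) c2 mulN1r.
  by rewrite [X in _ + X = _]addrC addrACA; congr (_ + _); apply: addrC.
have i2 : 'i * 'i = -1 :> C by rewrite -expr2 sqrCi.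
have [w1|] := eig _ 'i i2 erefl; last by left.
have [w2|] := eig _ (- 'i) (etrans (mulrNN _ _) i2) erefl; last by rewrite mulNr; right.
case/eqP: v_neq0.
have l0 : l = 0.
  apply/eqP; have := congr2 +%R w1 w2; rewrite scaleNr addrACA subrr !addr0.
  by move/eqP; rewrite -mulr2n -scaler_nat scaler_eq0 pnatr_eq0.
move: w1; rewrite l0 add0r => /eqP; rewrite scaler_eq0 (negPf (neq0Ci _)) /= => /eqP ->.
by rewrite row_mx0.
Qed.

(** * Hankel structure of intertwining matrices *)

(** Entrywise the relation reads [Z (i+1) j = Z i (j+1)], with entries just past the border read as
    zero. So [Z] is constant along antidiagonals, and those that can be slid over the border
    vanish. *)
Lemma ut_hankel_intertwine (K : fieldType) p q (Z : 'M[K]_(p, q)) :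
  jordan0 K p *m Z = Z *m (jordan0 K q)^T -> ut_hankel Z.
Proof.
move=> JZ.
(* Extending [Z] by zero gives meaning to row [p] and column [q], so that the shift rule holds up to
   and including the border. *)
pose z a b := if insub a is Some i then if insub b is Some j then Z i j else 0 else 0.
have zE (i : 'I_p) (j : 'I_q) : z i j = Z i j by rewrite /z !valK.
have z_row b : z p b = 0 by rewrite /z insubF // ltnn.
have z_col a : z a q = 0.
  by rewrite /z; case: insubP => // i _ _; rewrite insubF // ltnn.
have zS a b : (a < p)%N -> (b < q)%N -> z a.+1 b = z a b.+1.
  move=> lt_ap lt_bq; have /matrixP/(_ (Ordinal lt_ap) (Ordinal lt_bq)) := JZ.
  rewrite !mxE => JZab.
  transitivity (\sum_j jordan0 K p (Ordinal lt_ap) j * Z j (Ordinal lt_bq)).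
    rewrite /z (insubT (fun x => x < q)%N lt_bq) /=; case: insubP => [i _ def_i | /negPf ge_p].
      rewrite (bigD1 i) //= big1 ?addr0 => [|l ne_l]; rewrite !mxE /= -def_i.
        by rewrite eqxx mul1r.
      by rewrite eq_sym (inj_eq val_inj) (negPf ne_l) mul0r.
    rewrite big1 // => l _; rewrite !mxE /=; case: eqP => [eq_l|]; last by rewrite mul0r.
    by move: ge_p; rewrite eq_l ltn_ord.
  rewrite {}JZab /z (insubT (fun x => x < p)%N lt_ap) /=; case: insubP => [i _ def_i | /negPf ge_q].
    rewrite (bigD1 i) //= big1 ?addr0 => [|l ne_l]; rewrite !mxE /= -def_i.
      by rewrite eqxx mulr1.
    by rewrite eq_sym (inj_eq val_inj) (negPf ne_l) mulr0.
  rewrite big1 // => l _; rewrite !mxE /=; case: eqP => [eq_l|]; last by rewrite mulr0.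
  by move: ge_q; rewrite eq_l ltn_ord.
have z_shift e a b : (a + e <= p)%N -> (b + e <= q)%N -> z a (b + e)%N = z (a + e)%N b.
  elim: e a => [|e IHe] a; first by rewrite !addn0.
  by rewrite !addnS => lt_p lt_q; rewrite -zS ?IHe ?addSn //; lia.
(* Constants are numbered from 1, so the constant [t] is entry [t.-1] of the first column. Beyond
   the minimum, an entry slides down to row [p] if [p <= q], and right to column [q] otherwise. *)
exists (fun t => if (t <= minn p q)%N then z t.-1 0%N else 0); split=> [i j|t lt_t].
  have lt_i := ltn_ord i; have lt_j := ltn_ord j; rewrite -zE.
  case: ifP => [lt_min|/negbT ge_min] /=.
    by rewrite -z_shift ?add0n //; lia.
  have [le_pq|lt_qp] := leqP p q.
    have -> : nat_of_ord j = (j - (p - i) + (p - i))%N by lia.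
    by rewrite z_shift ?subnKC ?z_row //; lia.
  have -> : nat_of_ord i = (i - (q - j) + (q - j))%N by lia.
  by rewrite -z_shift ?subnKC ?z_col //; lia.
by rewrite leqNgt lt_t.
Qed.

(** * Alternating signs and the skew-Hankel form *)

Lemma altmx_sqr (K : fieldType) p : altmx K p *m altmx K p = 1%:M.
Proof.
rewrite /altmx mulmx_diag -diag_const_mx; congr diag_mx; apply/rowP => i.
by rewrite !mxE -expr2 sqrr_sign.
Qed.

Lemma altmx_jordan0 (K : fieldType) p :
  altmx K p *m jordan0 K p = - (jordan0 K p *m altmx K p).
Proof.
rewrite /altmx mul_diag_mx mul_mx_diag; apply/matrixP => i j; rewrite !mxE.
by case: eqP => [<-|_]; rewrite ?mulr0 ?mul0r ?oppr0 // exprS mulr1 mul1r mulN1r opprK.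
Qed.

(** The alternating sign matrix anticommutes with the nilpotent block, so multiplying by it removes
    the minus sign. *)
Lemma ut_skew_hankel_intertwine (K : fieldType) p q (Z : 'M[K]_(p, q)) :
  jordan0 K p *m Z = - (Z *m (jordan0 K q)^T) -> ut_skew_hankel Z.
Proof.
move=> JZ; apply: ut_hankel_intertwine.
rewrite mulmxA -[jordan0 K p *m _]opprK -altmx_jordan0 mulNmx -!mulmxA JZ.
by rewrite mulmxN opprK.
Qed.

Lemma ut_hankel_blocks_intertwine (K : fieldType) m (d : 'I_m -> nat)
    (Z : 'M[K]_(\sum_t d t)) :
  Defs.nilp K d *m Z = Z *m (Defs.nilp K d)^T -> ut_hankel_blocks Z.
Proof.
move=> NZ i t; apply: ut_hankel_intertwine.
move: NZ; rewrite -{1 2}(submxblockK Z) tr_mxdiag mul_mxdiag_mxblock.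
by rewrite mul_mxblock_mxdiag => /eq_mxblockP.
Qed.

Lemma ut_skew_hankel_blocks_intertwine (K : fieldType) m (d : 'I_m -> nat)
    (Z : 'M[K]_(\sum_t d t)) :
  Defs.nilp K d *m Z = - (Z *m (Defs.nilp K d)^T) -> ut_skew_hankel_blocks Z.
Proof.
move=> NZ i t; apply: ut_skew_hankel_intertwine.
move: NZ; rewrite -{1 2}(submxblockK Z) tr_mxdiag mul_mxdiag_mxblock.
by rewrite mul_mxblock_mxdiag -mxblockN => /eq_mxblockP.
Qed.

(** The involution that makes a Jordan matrix at [a] similar to minus the one at [- a]. *)
Definition altblk (K : fieldType) m (d : 'I_m -> nat) : 'M[K]_(\sum_t d t) :=
  \mxdiag_t altmx K (d t).

Lemma altblk_sqr (K : fieldType) m (d : 'I_m -> nat) :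
  altblk K d *m altblk K d = 1%:M.
Proof.
by rewrite mul_mxdiag -mxdiagZ; apply: eq_mxdiag => t; apply: altmx_sqr.
Qed.

Lemma altblk_jordanblk (K : fieldType) m (d : 'I_m -> nat) (a : K) :
  altblk K d *m jordanblk d a = - jordanblk d (- a) *m altblk K d.
Proof.
rewrite /jordanblk raddfN opprD opprK mulmxDr mulmxDl scalar_mxC mulNmx.
by rewrite !mul_mxdiag -mxdiagN; congr (_ + _); apply: eq_mxdiag => t; apply: altmx_jordan0.
Qed.

(** The hypothesis says [Y = c L (L Y)] for [L Y = A Y - Y B]. Each substitution replaces [Y] by
    terms [A^i Y B^j] of total degree two higher, and every term of degree at least [e + f] is
    zero. *)
Lemma nilpotent_fixpoint_eq0 (K : fieldType) p q e f (A : 'M[K]_p) (B : 'M[K]_q)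
    (c : K) (Y : 'M[K]_(p, q)) :
  A ^+ e = 0 -> B ^+ f = 0 ->
  Y = c *: (A *m (A *m Y - Y *m B) - (A *m Y - Y *m B) *m B) -> Y = 0.
Proof.
move=> Ae0 Bf0 defY.
(* Here [l] bounds how far the degree [i + j] falls short of [e + f]. *)
suff AYB l i j : (e + f <= i + j + l)%N -> A ^+ i *m Y *m B ^+ j = 0.
  by have /= := AYB (e + f)%N 0%N 0%N (leqnn _); rewrite !expr0 mul1mx mulmx1.
elim: l i j => [|l IHl] i j le_l.
  have [le_ei|lt_ie] := leqP e i.
    by rewrite -(subnKC le_ei) exprD Ae0 mul0r !mul0mx.
  have le_fj : (f <= j)%N by lia.
  by rewrite -(subnKC le_fj) exprD Bf0 mul0r mulmx0.
rewrite defY -scalemxAr -scalemxAl.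
have -> : A ^+ i *m (A *m (A *m Y - Y *m B) - (A *m Y - Y *m B) *m B) *m B ^+ j =
    A ^+ i.+2 *m Y *m B ^+ j - A ^+ i.+1 *m Y *m B ^+ j.+1
    - (A ^+ i.+1 *m Y *m B ^+ j.+1 - A ^+ i *m Y *m B ^+ j.+2).
  rewrite (exprSr A i.+1) (exprSr A i) (exprS B j.+1) (exprS B j) -!mulmxE.
  by rewrite !mulmxBr !mulmxBl !mulmxBr !mulmxBl !mulmxA.
by rewrite !IHl ?subrr ?scaler0 //; lia.
Qed.

(** The map [L Z = A Z - Z B] is nilpotent, and eliminating [Q], [S] and [T]
    from the four block equations leaves [L P = - L^3 P / (4 b^2)]. *)
Lemma rotation_intertwine (K : numFieldType) p q e f (A : 'M[K]_p) (B : 'M[K]_q)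
    (a b : K) (P Q S T : 'M[K]_(p, q)) :
  A ^+ e = 0 -> B ^+ f = 0 -> b != 0 ->
  block_mx (a%:M + A) b%:M (- b)%:M (a%:M + A) *m block_mx P Q S T =
  block_mx P Q S T *m block_mx (a%:M + B) (- b)%:M b%:M (a%:M + B) ->
  [/\ S = Q, T = - P, A *m P = P *m B & A *m Q = Q *m B].
Proof.
move=> Ae0 Bf0 b0; rewrite !mulmx_block => /eq_block_mx[].
rewrite !mulmxDl !mulmxDr !mul_scalar_mx !mul_mx_scalar.
set L := fun Z : 'M_(p, q) => A *m Z - Z *m B.
have LD Y Z : L (Y + Z) = L Y + L Z by rewrite /L mulmxDl mulmxDr opprD addrACA.
have LZ c Z : L (c *: Z) = c *: L Z by rewrite /L -scalemxAl -scalemxAr scalerBr.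
have AE Z : A *m Z = L Z + Z *m B by rewrite subrK.
move=> E11 E12 E21 E22; rewrite !AE in E11 E12 E21 E22.
have cancel (U V W U' : 'M[K]_(p, q)) : U = U' -> V - W = U - U' -> V = W.
  by move=> ->; rewrite subrr => /eqP; rewrite subr_eq0 => /eqP.
have LP : L P = b *: (Q - S).
  by apply: cancel E11 _; apply/matrixP => i j; move: (P *m B) (L P) => ? ?;
    rewrite !mxE; ring.
have LQ : L Q = - b *: (P + T).
  by apply: cancel E12 _; apply/matrixP => i j; move: (Q *m B) (L Q) => ? ?;
    rewrite !mxE; ring.
have LS : L S = b *: (P + T).
  by apply: cancel E21 _; apply/matrixP => i j; move: (S *m B) (L S) => ? ?;
    rewrite !mxE; ring.
have LT : L T = b *: (Q - S).
  by apply: cancel E22 _; apply/matrixP => i j; move: (T *m B) (L T) => ? ?;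
    rewrite !mxE; ring.
have LN Z : L (- Z) = - L Z by rewrite -scaleN1r LZ scaleN1r.
have LLP : L (L P) = - (2 * b ^+ 2) *: (P + T).
  rewrite LP LZ LD LN LQ LS; apply/matrixP => i j; rewrite !mxE; ring.
have LP0 : L P = 0.
  apply: (nilpotent_fixpoint_eq0 Ae0 Bf0 (c := - (4 * b ^+ 2)^-1)).
  rewrite -/(L (L P)) -/(L (L (L P))) LLP LZ LD LT -LP -mulr2n -scaler_nat !scalerA.
  by rewrite [X in _ = X *: _](_ : _ = 1) ?scale1r //; field; rewrite b0.
(* Once [L P = 0], the formula for [L P] forces [S = Q] and the one for [L (L P)] forces [T = - P],
   because [b] and 2 are nonzero. *)
have /eqP := LP; rewrite LP0 eq_sym scaler_eq0 (negPf b0) subr_eq0 => /eqP QS.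
have := LLP; rewrite LP0 /L mulmx0 mul0mx subr0 => /esym/eqP.
rewrite scaler_eq0 oppr_eq0 mulf_eq0 pnatr_eq0 expf_eq0 (negPf b0) /= addr_eq0.
move=> /eqP PT; have LQ0 : L Q = 0 by rewrite LQ PT addNr scaler0.
by split; [rewrite QS | rewrite PT opprK | rewrite AE LP0 add0r | rewrite AE LQ0 add0r].
Qed.

(** * Spectra under negation, transposition and field extension; shifted intertwining *)

Lemma eigenvalue_opp (K : fieldType) p (A : 'M[K]_p) z :
  eigenvalue (- A) z = eigenvalue A (- z).
Proof.
rewrite !eigenvalueE; have -> : - A - z%:M = -1 *: (A - (- z)%:M).
  by rewrite raddfN opprK scaleN1r opprD.
by rewrite unitmxZ ?unitrN1.
Qed.

Lemma map_nilp (K L : fieldType) (f : {rmorphism K -> L}) m (d : 'I_m -> nat) :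
  map_mx f (Defs.nilp K d) = Defs.nilp L d.
Proof.
apply/mxblockP => i j; rewrite /submxblock -map_mxsub -!/(submxblock _ _ _).
rewrite !mxblockK; case: eqVneq => [eij|_]; last by rewrite map_mx0.
case: j / eij; rewrite !conform_mx_id; apply/matrixP => a b.
by rewrite !mxE rmorph_nat.
Qed.

Lemma map_jordanblk (K L : fieldType) (f : {rmorphism K -> L}) m (d : 'I_m -> nat)
    (a : K) :
  map_mx f (jordanblk d a) = jordanblk d (f a).
Proof. by rewrite /jordanblk map_mxD map_scalar_mx map_nilp. Qed.

Lemma map_real_jordanblk (K L : fieldType) (f : {rmorphism K -> L}) m
    (d : 'I_m -> nat) (a b : K) :
  map_mx f (real_jordanblk d a b) = real_jordanblk d (f a) (f b).
Proof.
by rewrite /real_jordanblk map_block_mx !map_scalar_mx rmorphN map_jordanblk.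
Qed.

Lemma Re_eigenvalue_real_jordanblk (R : realType) m (d : 'I_m -> nat) (a b : R) z :
  eigenvalue (map_mx (real_complex R) (real_jordanblk d a b)) z ->
  complex.Re z = a.
Proof.
rewrite map_real_jordanblk => /eigenvalue_real_jordanblk.
by rewrite -complexiE => -[] -> /=; rewrite ?mul0r ?mulr0 !(subrr, subr0, oppr0, addr0).
Qed.

Lemma tr_jordanblk (K : fieldType) m (d : 'I_m -> nat) (a : K) :
  (jordanblk d a)^T = a%:M + (Defs.nilp K d)^T.
Proof. by rewrite /jordanblk linearD /= tr_scalar_mx. Qed.

Lemma nilp_tr_nilpotent (K : fieldType) m (d : 'I_m -> nat) :
  exists e, (Defs.nilp K d)^T ^+ e = 0.
Proof.
have [e Ne0] := nilp_nilpotent K d; exists e.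
suff -> : (Defs.nilp K d)^T ^+ e = (Defs.nilp K d ^+ e)^T by rewrite Ne0 trmx0.
elim: e {Ne0} => [|e IHe]; first by rewrite !expr0 trmx1.
by rewrite exprS exprSr IHe -!mulmxE trmx_mul.
Qed.

(** Here [A Z - Z B = (b - a) Z], so [Z] is a fixed point of the squared Sylvester map divided by
    the square of [b - a]. Nilpotency alone is used, which makes this valid over any field. *)
Lemma shift_intertwine (K : fieldType) p q e f (A : 'M[K]_p) (B : 'M[K]_q)
    (a b : K) (Z : 'M[K]_(p, q)) :
  A ^+ e = 0 -> B ^+ f = 0 -> (a%:M + A) *m Z = Z *m (b%:M + B) -> a != b ->
  Z = 0.
Proof.
move=> Ae0 Bf0; rewrite mulmxDl mulmxDr mul_scalar_mx mul_mx_scalar => AZ neq_ab.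
have LZ : A *m Z - Z *m B = (b - a) *: Z.
  apply/eqP; rewrite subr_eq scalerBl -[X in X == _](addKr (a *: Z)) AZ.
  by rewrite addrA addrC [- _ + _]addrC addrC.
apply: (nilpotent_fixpoint_eq0 Ae0 Bf0 (c := (b - a) ^- 2)).
rewrite LZ -scalemxAr -scalemxAl -scalerBr LZ !scalerA -mulrA -expr2.
by rewrite mulVf ?scale1r // expf_eq0 subr_eq0 eq_sym.
Qed.

Lemma shift_cancel (K : fieldType) p q (A : 'M[K]_p) (B : 'M[K]_q) (a : K)
    (Z : 'M[K]_(p, q)) :
  (a%:M + A) *m Z = Z *m (a%:M + B) -> A *m Z = Z *m B.
Proof.
by rewrite mulmxDl mulmxDr mul_scalar_mx mul_mx_scalar => /addrI.
Qed.

Lemma eigenvalue_tr_sim (K : fieldType) p (P A B : 'M[K]_p) z :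
  P *m P = 1%:M -> P *m A = B^T *m P -> eigenvalue B z = eigenvalue A z.
Proof.
move=> PP PA; rewrite -eigenvalue_tr; symmetry; apply: eigenvalue_sim PA.
by case: (mulmx1_unit PP).
Qed.

(** Each [B' j] has the spectrum of [B j], since the involution [P] makes [B j] similar to its
    transpose; off the diagonal the Sylvester equation then has disjoint spectra. *)
Lemma disjoint_intertwine (C : closedFieldType) s (p : 'I_s -> nat)
    (B B' : forall j, 'M[C]_(p j)) :
  disjoint_spectra B ->
  (forall j, exists2 P : 'M_(p j), P *m P = 1%:M & P *m B j = (B' j)^T *m P) ->
  forall i j (Z : 'M_(p i, p j)), i != j -> B i *m Z = Z *m B' j -> Z = 0.
Proof.
move=> disj simB i j Z nij; apply: sylvester_eq0 => z.
by have [P PP PB] := simB j; rewrite (eigenvalue_tr_sim z PP PB) disj.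
Qed.

Lemma disjoint_intertwine_real (R : realType) s (p : 'I_s -> nat)
    (B B' : forall j, 'M[R]_(p j)) :
  disjoint_spectra_real B ->
  (forall j, exists2 P : 'M_(p j), P *m P = 1%:M & P *m B j = (B' j)^T *m P) ->
  forall i j (Z : 'M_(p i, p j)), i != j -> B i *m Z = Z *m B' j -> Z = 0.
Proof.
move=> disj simB i j Z nij; apply: sylvester_eq0_real => z.
have [P PP PB] := simB j.
pose f := real_complex R.
have fPP : map_mx f P *m map_mx f P = 1%:M by rewrite -map_mxM PP map_mx1.
have fPB : map_mx f P *m map_mx f (B j) = (map_mx f (B' j))^T *m map_mx f P.
  by rewrite map_trmx -!map_mxM PB.
by rewrite (eigenvalue_tr_sim z fPP fPB) disj.
Qed.

Lemma swap_sqr (K : fieldType) p (D : 'M[K]_p) : D *m D = 1%:M ->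
  block_mx 0 D D 0 *m block_mx 0 D D 0 = 1%:M.
Proof.
move=> DD; rewrite mulmx_block !mulmx0 !mul0mx !addr0 !add0r DD.
by rewrite -scalar_mx_block.
Qed.

Lemma altblk2_real_jordanblk (K : fieldType) m (d : 'I_m -> nat) (a b : K) :
  diag2 (altblk K d) (altblk K d) *m real_jordanblk d a b =
  - real_jordanblk d (- a) (- b) *m diag2 (altblk K d) (altblk K d).
Proof.
rewrite /diag2 /real_jordanblk opp_block_mx !mulmx_block.
have DC c : altblk K d *m c%:M = - (- c)%:M *m altblk K d.
  by rewrite scalar_mxC raddfN /= opprK.
by rewrite !mulmx0 !mul0mx !addr0 !add0r !altblk_jordanblk !DC.
Qed.

Lemma diag2_sqr (K : fieldType) p (D : 'M[K]_p) : D *m D = 1%:M ->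
  diag2 D D *m diag2 D D = 1%:M.
Proof.
move=> DD; rewrite mulmx_block !mulmx0 !mul0mx !addr0 !add0r DD.
by rewrite -scalar_mx_block.
Qed.

(** * Diagonal blocks *)

Lemma rotation_blocks (K : numFieldType) p e f (A B : 'M[K]_p) (a b : K)
    (G : 'M[K]_(p + p)) :
  A ^+ e = 0 -> B ^+ f = 0 -> b != 0 ->
  block_mx (a%:M + A) b%:M (- b)%:M (a%:M + A) *m G =
    G *m block_mx (a%:M + B) (- b)%:M b%:M (a%:M + B) ->
  exists U W, [/\ G = block_mx U W W (- U), A *m U = U *m B & A *m W = W *m B].
Proof.
move=> Ae0 Bf0 b0; rewrite -[G]submxK.
case/(rotation_intertwine Ae0 Bf0 b0) => eqW eqU NU NW.
by exists (ulsubmx G), (ursubmx G); split=> //; rewrite eqW eqU.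
Qed.

Lemma tr_real_jordanblk (K : fieldType) m (d : 'I_m -> nat) (a b : K) :
  (real_jordanblk d a b)^T =
  block_mx (a%:M + (Defs.nilp K d)^T) (- b)%:M b%:M (a%:M + (Defs.nilp K d)^T).
Proof. by rewrite tr_block_mx !tr_jordanblk !tr_scalar_mx. Qed.

Lemma opp_tr_jordanblk (K : fieldType) m (d : 'I_m -> nat) (a : K) :
  - (jordanblk d a)^T = (- a)%:M + - (Defs.nilp K d)^T.
Proof. by rewrite tr_jordanblk opprD raddfN. Qed.

Lemma opp_tr_real_jordanblk (K : fieldType) m (d : 'I_m -> nat) (a b : K) :
  - (real_jordanblk d a b)^T =
  block_mx ((- a)%:M + - (Defs.nilp K d)^T) b%:M
           (- b)%:M ((- a)%:M + - (Defs.nilp K d)^T).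
Proof.
rewrite tr_block_mx opp_block_mx !opp_tr_jordanblk !tr_scalar_mx.
by rewrite [(- b)%:M]raddfN /= opprK.
Qed.

Lemma opp_tr_diag2 (K : fieldType) p q (A : 'M[K]_p) (B : 'M[K]_q) :
  - (diag2 A B)^T = diag2 (- A^T) (- B^T).
Proof. by rewrite tr_block_mx opp_block_mx !trmx0 !oppr0. Qed.

Lemma T_skew_block (R : realType) (c : bool) m (d : 'I_m -> nat) (a b : R)
    (G : 'M[R]_(if c then \sum_t d t + \sum_t d t else \sum_t d t)%N) :
  let B := sel c (real_jordanblk d a b) (jordanblk d a) in
  (c -> b != 0) -> B *m G = G *m B^T -> G^T = - G ->
  exists U W : 'M_(\sum_t d t), [/\ G = sel c (block_mx U W W (- U)) U,
    U^T = - U /\ ut_hankel_blocks U & c -> W^T = - W /\ ut_hankel_blocks W].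
Proof.
case: c G => /= G b0 BG GT; last first.
  exists G, 0; split=> //; split=> //; apply: ut_hankel_blocks_intertwine.
  by move: BG; rewrite tr_jordanblk => /shift_cancel.
move: BG; rewrite tr_real_jordanblk.
have [e Ne0] := nilp_tr_nilpotent R d; have [f Nf0] := nilp_nilpotent R d.
case/(rotation_blocks Nf0 Ne0 (b0 isT)).
move=> U [W [defG NU NW]]; exists U, W.
move: GT; rewrite defG tr_block_mx opp_block_mx => /eq_block_mx[UT WT _ _].
by split=> //; split=> //; apply: ut_hankel_blocks_intertwine.
Qed.

(** For the paired blocks, the diagonal parts of [G] intertwine matrices with different spectra and
    vanish, and symmetry links the two off-diagonal parts. The purely imaginary and nilpotent blocks
    leave a single equation. *)
Lemma T_odd_block (R : realType) (c1 c2 c3 : bool) m (d : 'I_m -> nat) (a b : R)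
    (G : 'M[R]_(if c1 then (\sum_t d t + \sum_t d t) + (\sum_t d t + \sum_t d t)
                else if c2 then \sum_t d t + \sum_t d t
                else if c3 then \sum_t d t + \sum_t d t else \sum_t d t)%N) :
  let B := sel c1 (diag2 (real_jordanblk d a b) (real_jordanblk d (- a) (- b)))
          (sel c2 (real_jordanblk d 0 b)
          (sel c3 (diag2 (jordanblk d a) (jordanblk d (- a))) (Defs.nilp R d))) in
  (c1 -> a != 0 /\ b != 0) -> (~~ c1 && c2 -> b != 0) ->
  (~~ (c1 || c2) && c3 -> a != 0) ->
  B *m G = G *m (- B^T) -> G^T = G ->
  exists U1 U2 W1 W2 V H : 'M_(\sum_t d t),
  let U := block_mx U1 U2 U2 (- U1) in
  [/\ G = sel c1 (block_mx 0 U U^T 0) (sel c2 (block_mx W1 W2 (- W2) W1)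
                                      (sel c3 (block_mx 0 V V^T 0) H)),
      c1 -> ut_skew_hankel_blocks U1 /\ ut_skew_hankel_blocks U2,
      ~~ c1 && c2 -> [/\ W1^T = W1, ut_skew_hankel_blocks W1, W2^T = - W2
                       & ut_skew_hankel_blocks W2],
      ~~ (c1 || c2) && c3 -> ut_skew_hankel_blocks V
    & ~~ [|| c1, c2 | c3] -> H^T = H /\ ut_skew_hankel_blocks H].
Proof.
have [e Ne0] := nilp_tr_nilpotent R d; have [f Nf0] := nilp_nilpotent R d.
have NNe0 : (- (Defs.nilp R d)^T) ^+ e = 0 by rewrite exprNn Ne0 mulr0.
have NNf0 : (- Defs.nilp R d) ^+ f = 0 by rewrite exprNn Nf0 mulr0.
case: c1 G => /= [G ab0 _ _ BG GT | ].
  have [a0 b0] := ab0 isT.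
  move: BG GT; rewrite -[G]submxK; set P := ulsubmx G; set Q := ursubmx G.
  set S := dlsubmx G; set T := drsubmx G.
  rewrite opp_tr_diag2 /diag2 !mulmx_block !mulmx0 !mul0mx !addr0 !add0r.
  case/eq_block_mx => EP EQ _ ET; rewrite tr_block_mx => /eq_block_mx[_ _ QT _].
  (* The eigenvalues on the left have real part [x] and those on the right [- x]. *)
  have rot0 x y (Z : 'M[R]_(\sum_t d t + \sum_t d t)) :
      x != 0 ->
      real_jordanblk d x y *m Z = Z *m - (real_jordanblk d x y)^T -> Z = 0.
    move=> x0 RZ; apply: sylvester_eq0_real RZ => z; apply/negP => /andP[].
    move=> /Re_eigenvalue_real_jordanblk Rez; rewrite map_mxN eigenvalue_opp.
    rewrite -map_trmx eigenvalue_tr => /Re_eigenvalue_real_jordanblk.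
    case: (z) Rez => /= u v -> /eqP; rewrite eq_sym -subr_eq0 opprK -mulr2n.
    by rewrite mulrn_eq0 /= (negPf x0).
  (* Negation and transposition of the second block bring back the parameters [a] and [b], with
     nilpotent part [- N^T], so the rotation equation applies. *)
  move: EQ; rewrite opp_tr_real_jordanblk !opprK.
  case/(rotation_blocks Nf0 NNe0 b0) => U1 [U2 [defQ NU1 NU2]].
  exists U1, U2, 0, 0, 0, 0; split=> //=.
    by rewrite (rot0 _ _ _ a0 EP) (rot0 _ _ _ _ ET) ?oppr_eq0 // -QT -defQ.
  by rewrite !mulmxN in NU1 NU2; split; apply: ut_skew_hankel_blocks_intertwine.
case: c2 => /= [G _ b0 _ BG GT | ].
  (* Conjugating by [E] and negating keeps the rotation part of the block and changes the sign of
     its nilpotent part. The equation for [E *m G] thus has the rotation form, and undoing [E]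
     negates the second block row. *)
  pose E : 'M[R]_(\sum_t d t + \sum_t d t) := diag2 1%:M (- 1%:M).
  have EE : E *m E = 1%:M.
    rewrite mulmx_block !mulmx0 !mul0mx !addr0 !add0r mulmxN mulNmx opprK !mulmx1.
    by rewrite -scalar_mx_block.
  have EG : block_mx (0%:M + - Defs.nilp R d) b%:M (- b)%:M (0%:M + - Defs.nilp R d)
      *m (E *m G) =
      (E *m G) *m block_mx (0%:M + (Defs.nilp R d)^T) (- b)%:M b%:M
                           (0%:M + (Defs.nilp R d)^T).
    rewrite -tr_real_jordanblk -mulmxA -[_^T]opprK mulmxN -BG -mulNmx !mulmxA.
    congr (_ *m _); rewrite /E /real_jordanblk /jordanblk mulmxN !mulmx_block.
    rewrite !(mulmx1, mul1mx, mulmx0, mul0mx, addr0, add0r, mulmxN, mulNmx).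
    by rewrite opp_block_mx !raddf0 !add0r [(- b)%:M]raddfN /= !opprK.
  have [P [Q [defG NP NQ]]] := rotation_blocks NNf0 Ne0 (b0 isT) EG.
  have {}defG : G = block_mx P Q (- Q) P.
    rewrite -[G]mul1mx -EE -mulmxA defG mulmx_block.
    by rewrite !(mul1mx, mul0mx, addr0, add0r, mulNmx, mulmxN, opprK, oppr0).
  exists 0, 0, P, Q, 0, 0; split=> //=.
  move: GT; rewrite defG tr_block_mx => /eq_block_mx[PT _ QT _].
  split=> //; last 1 first.
  - by apply: ut_skew_hankel_blocks_intertwine; rewrite -NQ mulNmx opprK.
  - by apply: ut_skew_hankel_blocks_intertwine; rewrite -NP mulNmx opprK.
case: c3 => /= [G _ _ a0 BG GT | G _ _ _ BG GT]; last first.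
  exists 0, 0, 0, 0, 0, G; split=> //= _; split=> //.
  by apply: ut_skew_hankel_blocks_intertwine; rewrite BG mulmxN.
move: BG GT; rewrite -[G]submxK; set P := ulsubmx G; set Q := ursubmx G.
set S := dlsubmx G; set T := drsubmx G.
rewrite opp_tr_diag2 /diag2 !mulmx_block !mulmx0 !mul0mx !addr0 !add0r !opp_tr_jordanblk opprK.
case/eq_block_mx => [EP EQ _ ET].
rewrite tr_block_mx => /eq_block_mx[_ _ QT _].
(* The diagonal parts intertwine the distinct shifts [a] and [- a], whereas for [Q] both shifts are
   [a] and cancel. *)
have neq_aN : a != - a by rewrite -subr_eq0 opprK -mulr2n mulrn_eq0 /= a0.
exists 0, 0, 0, 0, Q, 0; split=> //=.
  by rewrite (shift_intertwine Nf0 NNe0 EP) // (shift_intertwine Nf0 NNe0 ET)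
    // 1?eq_sym // QT.
move=> _; apply: ut_skew_hankel_blocks_intertwine.
by rewrite (shift_cancel EQ) mulmxN.
Qed.

(** * Conjugate transposes and the complex diagonal blocks *)

Lemma ctr_jordanblk (C : numClosedFieldType) m (d : 'I_m -> nat) (a : C) :
  (jordanblk d a) ^t* = (a^*)%:M + (Defs.nilp C d)^T.
Proof. by rewrite -map_trmx map_jordanblk tr_jordanblk. Qed.

Lemma ctr_block_mx (C : numClosedFieldType) p q r s (P : 'M[C]_(p, r))
    (Q : 'M[C]_(p, s)) (S : 'M[C]_(q, r)) (T : 'M[C]_(q, s)) :
  (block_mx P Q S T) ^t* = block_mx (P ^t*) (S ^t*) (Q ^t*) (T ^t*).
Proof. by rewrite tr_block_mx map_block_mx. Qed.

Lemma ctr_diag2 (C : numClosedFieldType) p q (A : 'M[C]_p) (B : 'M[C]_q) :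
  (diag2 A B) ^t* = diag2 (A ^t*) (B ^t*).
Proof. by rewrite ctr_block_mx !trmx0 !map_mx0. Qed.

Lemma conj_fixP (C : numClosedFieldType) (x : C) : (x \is Num.real) = (x^* == x).
Proof. by rewrite CrealE. Qed.

Lemma conj_antifixP (C : numClosedFieldType) (x : C) : ('Re x == 0) = (x == - x^*).
Proof.
by rewrite ReE mulf_eq0 invr_eq0 pnatr_eq0 orbF addr_eq0.
Qed.

(** In a conjugate pair the diagonal parts of [G] intertwine a shift with its distinct conjugate and
    vanish. In the off-diagonal part the conjugations cancel, leaving the Hankel equation. *)
Lemma H_hankel_block (C : numClosedFieldType) (c : bool) m (d : 'I_m -> nat)
    (a eps : C) (G : 'M[C]_(if c then \sum_t d t + \sum_t d t else \sum_t d t)%N) :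
  let B := sel c (diag2 (jordanblk d a) (jordanblk d a^*)) (jordanblk d a) in
  eps * eps = 1 -> (c -> a \isn't Num.real) -> (~~ c -> a \is Num.real) ->
  B *m G = G *m B ^t* -> G ^t* = eps *: G ->
  exists W : 'M_(\sum_t d t), [/\ G = sel c (block_mx 0 W (eps *: W ^t*) 0) W,
    ut_hankel_blocks W & ~~ c -> W ^t* = eps *: W].
Proof.
have [e Ne0] := nilp_tr_nilpotent C d; have [f Nf0] := nilp_nilpotent C d.
case: c G => /= G epsK areal aimag BG GH; last first.
  exists G; split=> //; apply: ut_hankel_blocks_intertwine.
  move: BG; rewrite ctr_jordanblk; move: (aimag isT).
  by rewrite conj_fixP => /eqP ->; apply: shift_cancel.
move: BG GH; rewrite -[G]submxK; set P := ulsubmx G; set Q := ursubmx G.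
set S := dlsubmx G; set T := drsubmx G.
rewrite ctr_diag2 /diag2 !mulmx_block.
rewrite !(mulmx0, mul0mx, addr0, add0r) !ctr_jordanblk conjCK.
case/eq_block_mx => [EP EQ _ ET].
rewrite ctr_block_mx scale_block_mx => /eq_block_mx[_ _ QH _].
have neq_a : a != a^* by rewrite eq_sym -conj_fixP; apply: areal.
exists Q; split=> //; last first.
  by apply: ut_hankel_blocks_intertwine; apply: shift_cancel EQ.
rewrite (shift_intertwine Nf0 Ne0 EP) // (shift_intertwine Nf0 Ne0 ET) 1?eq_sym //.
by rewrite QH scalerA epsK scale1r.
Qed.

(** The same argument with the reflection in the imaginary axis in place of conjugation; its fixed
    points are the numbers with zero real part. *)
Lemma H_skew_hankel_block (C : numClosedFieldType) (c : bool) m (d : 'I_m -> nat)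
    (a eps : C) (G : 'M[C]_(if c then \sum_t d t + \sum_t d t else \sum_t d t)%N) :
  let B := sel c (diag2 (jordanblk d a) (jordanblk d (- a^*))) (jordanblk d a) in
  eps * eps = 1 -> (c -> 'Re a != 0) -> (~~ c -> 'Re a = 0) ->
  B *m G = G *m - B ^t* -> G ^t* = eps *: G ->
  exists W : 'M_(\sum_t d t), [/\ G = sel c (block_mx 0 W (eps *: W ^t*) 0) W,
    ut_skew_hankel_blocks W & ~~ c -> W ^t* = eps *: W].
Proof.
have [e Ne0] := nilp_tr_nilpotent C d; have [f Nf0] := nilp_nilpotent C d.
have NNe0 : (- (Defs.nilp C d)^T) ^+ e = 0 by rewrite exprNn Ne0 mulr0.
have opp_ctr x : - (jordanblk d x) ^t* = (- x^*)%:M + - (Defs.nilp C d)^T.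
  by rewrite ctr_jordanblk opprD raddfN.
case: c G => /= G epsK areal aimag BG GH; last first.
  exists G; split=> //; apply: ut_skew_hankel_blocks_intertwine.
  move: BG; rewrite opp_ctr; move/eqP: (aimag isT).
  by rewrite conj_antifixP => /eqP <- /shift_cancel ->; rewrite mulmxN.
move: BG GH; rewrite -[G]submxK; set P := ulsubmx G; set Q := ursubmx G.
set S := dlsubmx G; set T := drsubmx G.
rewrite ctr_diag2 /diag2 opp_block_mx !mulmx_block.
rewrite !(mulmx0, mul0mx, addr0, add0r, oppr0) !opp_ctr [(- a^*)^*]rmorphN /= conjCK opprK.
case/eq_block_mx => [EP EQ _ ET].
rewrite ctr_block_mx scale_block_mx => /eq_block_mx[_ _ QH _].
have neq_a : a != - a^* by rewrite -conj_antifixP; apply: areal.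
exists Q; split=> //; last first.
  by apply: ut_skew_hankel_blocks_intertwine; rewrite (shift_cancel EQ) mulmxN.
rewrite (shift_intertwine Nf0 NNe0 EP) // (shift_intertwine Nf0 NNe0 ET) 1?eq_sym //.
by rewrite QH scalerA epsK scale1r.
Qed.

(** * Assembling the diagonal blocks *)

(** Gathers witnesses found block by block, whose types depend on the block, into one family; the
    choice comes from [cid]. *)
Lemma dependent_choice (I : Type) (T : I -> Type) (P : forall i, T i -> Prop) :
  (forall i, exists x, P i x) -> exists f : forall i, T i, forall i, P i (f i).
Proof.
by move=> exP; exists (fun i => projT1 (cid (exP i))) => i; case: cid.
Qed.

Lemma ctr_mxdiag (C : numClosedFieldType) s (p : 'I_s -> nat)
    (B : forall j, 'M[C]_(p j)) :
  (\mxdiag_j B j) ^t* = \mxdiag_j (B j) ^t*.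
Proof.
apply/mxblockP => i j; rewrite /submxblock tr_mxdiag -map_mxsub.
rewrite -!/(submxblock _ _ _) !mxblockK.
case: eqVneq => [eij|_]; last by rewrite map_mx0.
by case: j / eij; rewrite !conform_mx_id.
Qed.

Lemma ctr_submxblock (C : numClosedFieldType) s (p : 'I_s -> nat)
    (G : 'M[C]_(\sum_j p j)) i j :
  (submxblock G i j) ^t* = submxblock (G ^t*) j i.
Proof. by rewrite tr_submxblock /submxblock map_mxsub. Qed.

Lemma submxblockZ (K : fieldType) s (p : 'I_s -> nat) (c : K)
    (G : 'M[K]_(\sum_j p j)) i j :
  submxblock (c *: G) i j = c *: submxblock G i j.
Proof. by apply/matrixP => a b; rewrite !mxE. Qed.

Lemma ctrmxD (R : realType) p q (x y : 'M[R[i]]_(p, q)) :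
  ctrmx (x + y) = ctrmx x + ctrmx y.
Proof. by rewrite /ctrmx linearD map_mxD. Qed.

Lemma ctrmxM (R : realType) p q r (x : 'M[R[i]]_(p, q)) (y : 'M[R[i]]_(q, r)) :
  ctrmx (x *m y) = ctrmx y *m ctrmx x.
Proof. by rewrite /ctrmx trmx_mul map_mxM. Qed.

Lemma ctrmxK (R : realType) p q (x : 'M[R[i]]_(p, q)) : ctrmx (ctrmx x) = x.
Proof. exact: trmxCK. Qed.

Lemma T_skew_Gamma (R : realType) (n k : nat) (k_ge2 : (2 <= k)%N)
    (A : nat -> 'M[R]_n) (s r : nat) (m : 'I_s -> nat)
    (d : forall j, 'I_(m j) -> nat) (alpha beta : 'I_s -> R)
    (X : 'M[R]_(n, \sum_(j < s) dim1 r j (bsize d j))) :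
  let Jb := J1 r d alpha beta in
  let J := \mxdiag_(j < s) Jb j in
  T_skew_symmetric k A -> A k \in unitmx ->
  (forall j : 'I_s, (j < r)%N -> beta j != 0) ->
  disjoint_spectra_real Jb ->
  standard_pair k A X J ->
  exists Gamma : 'M[R]_(\sum_(j < s) dim1 r j (bsize d j)),
    [/\ Gamma \in unitmx,
        in_S (@trmx R) (-1) (-1) J Gamma,
        represents (@trmx R) k A X J Gamma
      & exists U W : forall j, 'M[R]_(bsize d j),
        [/\ Gamma = \mxdiag_(j < s) Gamma1 r U W j,
            forall j, (U j)^T = - U j /\ ut_hankel_blocks (U j)
          & forall j : 'I_s, (j < r)%N ->
              (W j)^T = - W j /\ ut_hankel_blocks (W j)]].
Proof.
move=> Jb J AT Aku beta0 disj XJ.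
have [G [Gu GS Grep]] := @structured_represents _ (@trmx R)
  (fun p q => @linearD _ _ _ _ _) (@trmx_mul _) (@trmxK _)
  n k _ _ _ A X J k_ge2 (or_intror erefl) (or_intror erefl) AT Aku XJ.
exists G; split=> //; case: GS => GT GJ.
have JG : J *m G = G *m \mxdiag_j (Jb j)^T.
  by rewrite -tr_mxdiag GJ mulrNN mulr1 scale1r.
have [|defG blkG] := mxdiag_intertwine JG.
  apply: disjoint_intertwine_real disj _ => j.
  (* The required similarity is with the transpose of [(Jb j)^T], which is [Jb j] itself. *)
  by exists 1%:M; rewrite ?mulmx1 // trmxK mul1mx.
have blk j : exists U W : 'M_(bsize d j),
    [/\ submxblock G j j = sel (j < r)%N (block_mx U W W (- U)) U,
    U^T = - U /\ ut_hankel_blocks U & (j < r)%N -> W^T = - W /\ ut_hankel_blocks W].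
  apply: T_skew_block (beta0 j) (blkG j) _.
  by rewrite tr_submxblock GT scaleN1r submxblockN.
have [U exW] := dependent_choice blk; have [W UW] := dependent_choice exW.
exists U, W; split=> [|j|j lt_jr]; last 2 first.
- by case: (UW j).
- by case: (UW j) => _ _ /(_ lt_jr).
by rewrite defG; apply: eq_mxdiag => j; case: (UW j).
Qed.

Lemma swap_diag2 (K : fieldType) p (D A B : 'M[K]_p) :
  D *m A = - B *m D -> D *m B = - A *m D ->
  block_mx 0 D D 0 *m diag2 A B = - diag2 A B *m block_mx 0 D D 0.
Proof.
move=> DA DB; rewrite /diag2 opp_block_mx !mulmx_block.
by rewrite !(mulmx0, mul0mx, addr0, add0r, oppr0) DA DB.
Qed.

(** The sign involution [D] sends a block at [a] to minus the block at [- a], so exchanging the two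
    halves settles the paired cases. For a rotation block at 0, the opposite sign on the second copy
    of [D] restores [b]. *)
Lemma T_odd_sim (K : fieldType) (c1 c2 c3 : bool) m (d : 'I_m -> nat) (a b : K) :
  let B := sel c1 (diag2 (real_jordanblk d a b) (real_jordanblk d (- a) (- b)))
          (sel c2 (real_jordanblk d 0 b)
          (sel c3 (diag2 (jordanblk d a) (jordanblk d (- a))) (Defs.nilp K d))) in
  exists2 P, P *m P = 1%:M & P *m B = - B *m P.
Proof.
have DD := altblk_sqr K d; set D := altblk K d in DD.
case: c1 => /=.
  exists (block_mx 0 (diag2 D D) (diag2 D D) 0); first by rewrite swap_sqr ?diag2_sqr.
  by apply: swap_diag2; rewrite altblk2_real_jordanblk ?opprK.
case: c2 => /=.
  exists (diag2 D (- D)).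
    rewrite mulmx_block !(mulmx0, mul0mx, addr0, add0r) mulmxN mulNmx opprK DD.
    by rewrite -scalar_mx_block.
  rewrite /diag2 /real_jordanblk opp_block_mx !mulmx_block.
  rewrite !(mulmx0, mul0mx, addr0, add0r, mulmxN, mulNmx) altblk_jordanblk oppr0.
  by rewrite [(- b)%:M]raddfN /= !(mulNmx, mulmxN, opprK) scalar_mxC.
case: c3 => /=.
  exists (block_mx 0 D D 0); first exact: swap_sqr.
  by apply: swap_diag2; rewrite altblk_jordanblk ?opprK.
exists D => //.
by have := altblk_jordanblk d (0 : K); rewrite oppr0 /jordanblk raddf0 add0r.
Qed.

Lemma T_odd_Gamma (R : realType) (n k : nat) (k_ge2 : (2 <= k)%N)
    (A : nat -> 'M[R]_n) (s r1 r2 : nat) (m : 'I_s -> nat)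
    (d : forall j, 'I_(m j) -> nat) (alpha beta : 'I_s -> R)
    (X : 'M[R]_(n, \sum_(j < s) dim2 s r1 r2 j (bsize d j))) :
  let Jb := J2 r1 r2 d alpha beta in
  let J := \mxdiag_(j < s) Jb j in
  T_odd k A -> A k \in unitmx ->
  (r1 <= r2 < s)%N ->
  (forall j : 'I_s, (j < r1)%N -> alpha j != 0 /\ beta j != 0) ->
  (forall j : 'I_s, (r1 <= j < r2)%N -> beta j != 0) ->
  (forall j : 'I_s, (r2 <= j < s.-1)%N -> alpha j != 0) ->
  disjoint_spectra_real Jb ->
  standard_pair k A X J ->
  exists Gamma : 'M[R]_(\sum_(j < s) dim2 s r1 r2 j (bsize d j)),
    [/\ Gamma \in unitmx,
        in_S (@trmx R) (-1) 1 J Gamma,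
        represents (@trmx R) k A X J Gamma
      & exists U1 U2 W1 W2 V G : forall j, 'M[R]_(bsize d j),
        [/\ Gamma = \mxdiag_(j < s) Gamma2 r1 r2 U1 U2 W1 W2 V G j,
            forall j : 'I_s, (j < r1)%N ->
              ut_skew_hankel_blocks (U1 j) /\ ut_skew_hankel_blocks (U2 j),
            forall j : 'I_s, (r1 <= j < r2)%N ->
              [/\ (W1 j)^T = W1 j, ut_skew_hankel_blocks (W1 j),
                  (W2 j)^T = - W2 j & ut_skew_hankel_blocks (W2 j)],
            forall j : 'I_s, (r2 <= j < s.-1)%N ->
              ut_skew_hankel_blocks (V j)
          & forall j : 'I_s, nat_of_ord j = s.-1 ->
              (G j)^T = G j /\ ut_skew_hankel_blocks (G j)]].
Proof.
move=> Jb J AT Aku /andP[le_r12 lt_r2s] ab0 b0 a0 disj XJ.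
have [G [Gu GS Grep]] := @structured_represents _ (@trmx R)
  (fun p q => @linearD _ _ _ _ _) (@trmx_mul _) (@trmxK _)
  n k _ _ _ A X J k_ge2 (or_intror erefl) (or_introl erefl) AT Aku XJ.
exists G; split=> //; case: GS => GT GJ.
have JG : J *m G = G *m \mxdiag_j (- (Jb j)^T).
  by rewrite mxdiagN -tr_mxdiag mulmxN GJ mulr1 scaleN1r opprK.
have [|defG blkG] := mxdiag_intertwine JG.
  apply: disjoint_intertwine_real disj _ => j; rewrite linearN /= trmxK.
  exact: T_odd_sim.
have blk j : exists U1 U2 W1 W2 V H : 'M_(bsize d j),
  let U := block_mx U1 U2 U2 (- U1) in
  let c1 := (j < r1)%N in let c2 := (j < r2)%N in let c3 := (j < s.-1)%N in
  [/\ submxblock G j j =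
        sel c1 (block_mx 0 U U^T 0) (sel c2 (block_mx W1 W2 (- W2) W1)
                                    (sel c3 (block_mx 0 V V^T 0) H)),
      c1 -> ut_skew_hankel_blocks U1 /\ ut_skew_hankel_blocks U2,
      ~~ c1 && c2 -> [/\ W1^T = W1, ut_skew_hankel_blocks W1, W2^T = - W2
                       & ut_skew_hankel_blocks W2],
      ~~ (c1 || c2) && c3 -> ut_skew_hankel_blocks V
    & ~~ [|| c1, c2 | c3] -> H^T = H /\ ut_skew_hankel_blocks H].
  apply: T_odd_block (@ab0 j) _ _ (blkG j) _.
  - by rewrite -leqNgt; apply: b0.
  - by move=> j_rng; apply: a0; lia.
  - by rewrite tr_submxblock GT scale1r.
have [U1 {}blk] := dependent_choice blk; have [U2 {}blk] := dependent_choice blk.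
have [W1 {}blk] := dependent_choice blk; have [W2 {}blk] := dependent_choice blk.
have [V {}blk] := dependent_choice blk; have [H {}blk] := dependent_choice blk.
exists U1, U2, W1, W2, V, H; split=> [|j lt_j|j rng_j|j rng_j|j eq_j].
- by rewrite {1}defG; apply: eq_mxdiag => j; case: (blk j).
- by case: (blk j) => _ /(_ lt_j).
- by case: (blk j) => _ _ /= + _ _; apply; lia.
- by case: (blk j) => _ _ _ /= + _; apply; lia.
by case: (blk j) => _ _ _ _ /=; apply; lia.
Qed.

(** An invertible leading coefficient of positive size is nonzero, so it cannot satisfy the
    structure relation with two different signs. *)
Lemma structured_sign (K : fieldType) (star : star_op K) n k (A : nat -> 'M[K]_n)
    (e1 e2 f1 f2 : K) :
  (0 < n)%N -> A k \in unitmx ->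
  structured star e1 e2 k A -> structured star f1 f2 k A ->
  (if odd k then e2 else e1) = (if odd k then f2 else f1).
Proof.
case: n A => // n A _ Aku Ae Af; apply/eqP; rewrite -subr_eq0.
have /eqP := etrans (esym (Ae k (leqnn k))) (Af k (leqnn k)).
rewrite -subr_eq0 -scalerBl scaler_eq0 => /orP[//|/eqP Ak0].
by move: Aku; rewrite Ak0 unitr0.
Qed.

(** Conjugating the entries exchanges the two halves of a conjugate pair, and the swap matrix
    exchanges them back; a real block is fixed. *)
Lemma H_hankel_sim (C : numClosedFieldType) (c : bool) m (d : 'I_m -> nat) (a : C) :
  let B := sel c (diag2 (jordanblk d a) (jordanblk d a^*)) (jordanblk d a) in
  (~~ c -> a \is Num.real) ->
  exists2 P, P *m P = 1%:M & P *m B = (B ^t*)^T *m P.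
Proof.
case: c => /= [_|/(_ isT) areal].
  exists (block_mx 0 1%:M 1%:M 0); first by apply: swap_sqr; rewrite mulmx1.
  rewrite ctr_diag2 /diag2 tr_block_mx !ctr_jordanblk conjCK !mulmx_block.
  by rewrite !(mulmx0, mul0mx, addr0, add0r, trmx0, mul1mx, mulmx1)
    !linearD /= !tr_scalar_mx !trmxK.
exists 1%:M; rewrite ?mulmx1 // mul1mx ctr_jordanblk linearD /= tr_scalar_mx trmxK.
by move: areal; rewrite conj_fixP => /eqP ->.
Qed.

Lemma H_skew_hankel_sim (C : numClosedFieldType) (c : bool) m (d : 'I_m -> nat)
    (a : C) :
  let B := sel c (diag2 (jordanblk d a) (jordanblk d (- a^*))) (jordanblk d a) in
  (~~ c -> 'Re a = 0) ->
  exists2 P, P *m P = 1%:M & P *m B = (- B ^t*)^T *m P.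
Proof.
have DD := altblk_sqr C d; set D := altblk C d in DD.
(* The sign involution combines negation with conjugation, giving the reflection of [x] in the
   imaginary axis. *)
have DJ x : D *m jordanblk d (- x^*) = (- (jordanblk d x) ^t*)^T *m D.
  rewrite altblk_jordanblk opprK ctr_jordanblk [(- (_ + _))^T]linearN /=.
  by rewrite [(_ + _)^T]linearD /= tr_scalar_mx trmxK.
have DJ' : D *m jordanblk d a = (- (jordanblk d (- a^*)) ^t*)^T *m D.
  by rewrite -DJ [(- a^*)^*]rmorphN /= conjCK opprK.
case: c => /= [_|/(_ isT)/eqP].
  exists (block_mx 0 D D 0); first exact: swap_sqr.
  rewrite ctr_diag2 /diag2 opp_block_mx tr_block_mx !mulmx_block.
  rewrite !(mulmx0, mul0mx, addr0, add0r, oppr0, trmx0) DJ.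
  by rewrite DJ'.
rewrite conj_antifixP => /eqP def_a; exists D => //.
by rewrite {1}def_a DJ.
Qed.

(** The scalar in the lower left blocks is [eps2], dictated by [Gamma] being its own conjugate
    transpose up to that sign. *)
Lemma H_hankel_Gamma (R : realType) (n k : nat) (k_ge2 : (2 <= k)%N)
    (eps1 eps2 : R[i]) (A : nat -> 'M[R[i]]_n) (s r : nat)
    (m : 'I_s -> nat) (d : forall j, 'I_(m j) -> nat) (lambda : 'I_s -> R[i])
    (X : 'M[R[i]]_(n, \sum_(j < s) dim1 r j (bsize d j))) :
  let Jb := J3 r d lambda in
  let J := \mxdiag_(j < s) Jb j in
  (eps1 = 1 \/ eps1 = -1) -> (eps2 = 1 \/ eps2 = -1) -> eps1 = eps2 ->
  structured (@ctrmx R) eps1 eps2 k A -> A k \in unitmx ->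
  (forall j : 'I_s, (j < r)%N -> lambda j \isn't Num.real) ->
  (forall j : 'I_s, (r <= j)%N -> lambda j \is Num.real) ->
  disjoint_spectra Jb ->
  standard_pair k A X J ->
  exists Gamma : 'M[R[i]]_(\sum_(j < s) dim1 r j (bsize d j)),
    [/\ Gamma \in unitmx,
        in_S (@ctrmx R) eps1 eps2 J Gamma,
        represents (@ctrmx R) k A X J Gamma
      & exists W : forall j, 'M[R[i]]_(bsize d j),
        [/\ Gamma = \mxdiag_(j < s) Gamma34 r eps2 W j,
            forall j, ut_hankel_blocks (W j)
          & forall j : 'I_s, (r <= j)%N -> (W j) ^t* = eps2 *: W j]].
Proof.
move=> Jb J sgn1 sgn2 eq_eps AH Aku nreal real disj XJ.
have epsK := sign_sqr sgn2.
have [G [Gu GS Grep]] := @structured_represents _ (@ctrmx R)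
  (@ctrmxD R) (@ctrmxM R) (@ctrmxK R)
  n k _ _ _ A X J k_ge2 sgn1 sgn2 AH Aku XJ.
exists G; split=> //; case: GS => GH GJ.
have JG : J *m G = G *m \mxdiag_j (Jb j) ^t*.
  by rewrite -ctr_mxdiag -/(ctrmx _) GJ eq_eps epsK scale1r.
have [|defG blkG] := mxdiag_intertwine JG.
  apply: disjoint_intertwine disj _ => j; apply: H_hankel_sim.
  by rewrite -leqNgt; apply: real.
have blk j : exists W : 'M_(bsize d j),
    [/\ submxblock G j j = sel (j < r)%N (block_mx 0 W (eps2 *: W ^t*) 0) W,
        ut_hankel_blocks W & ~~ (j < r)%N -> W ^t* = eps2 *: W].
  apply: H_hankel_block epsK (nreal j) _ (blkG j) _.
    by rewrite -leqNgt; apply: real.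
  by rewrite ctr_submxblock -/(ctrmx _) GH submxblockZ.
have [W {}blk] := dependent_choice blk.
exists W; split=> [|j|j le_rj].
- by rewrite {1}defG; apply: eq_mxdiag => j; case: (blk j).
- by case: (blk j).
by case: (blk j) => _ _; rewrite -leqNgt; apply.
Qed.

Lemma H_skew_hankel_Gamma (R : realType) (n k : nat) (k_ge2 : (2 <= k)%N)
    (eps1 eps2 : R[i]) (A : nat -> 'M[R[i]]_n) (s r : nat)
    (m : 'I_s -> nat) (d : forall j, 'I_(m j) -> nat) (lambda : 'I_s -> R[i])
    (X : 'M[R[i]]_(n, \sum_(j < s) dim1 r j (bsize d j))) :
  let Jb := J4 r d lambda in
  let J := \mxdiag_(j < s) Jb j in
  (eps1 = 1 \/ eps1 = -1) -> (eps2 = 1 \/ eps2 = -1) -> eps1 <> eps2 ->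
  structured (@ctrmx R) eps1 eps2 k A -> A k \in unitmx ->
  (forall j : 'I_s, (j < r)%N -> 'Re (lambda j) != 0) ->
  (forall j : 'I_s, (r <= j)%N -> 'Re (lambda j) = 0) ->
  disjoint_spectra Jb ->
  standard_pair k A X J ->
  exists Gamma : 'M[R[i]]_(\sum_(j < s) dim1 r j (bsize d j)),
    [/\ Gamma \in unitmx,
        in_S (@ctrmx R) eps1 eps2 J Gamma,
        represents (@ctrmx R) k A X J Gamma
      & exists W : forall j, 'M[R[i]]_(bsize d j),
        [/\ Gamma = \mxdiag_(j < s) Gamma34 r eps2 W j,
            forall j, ut_skew_hankel_blocks (W j)
          & forall j : 'I_s, (r <= j)%N -> (W j) ^t* = eps2 *: W j]].
Proof.
move=> Jb J sgn1 sgn2 neq_eps AH Aku nreal real disj XJ.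
have epsK := sign_sqr sgn2.
have eps12 : eps1 * eps2 = -1.
  by case: sgn1 sgn2 neq_eps => -> [] -> //; rewrite ?mulr1 ?mul1r.
have [G [Gu GS Grep]] := @structured_represents _ (@ctrmx R)
  (@ctrmxD R) (@ctrmxM R) (@ctrmxK R)
  n k _ _ _ A X J k_ge2 sgn1 sgn2 AH Aku XJ.
exists G; split=> //; case: GS => GH GJ.
have JG : J *m G = G *m \mxdiag_j - (Jb j) ^t*.
  by rewrite mxdiagN -ctr_mxdiag mulmxN -/(ctrmx _) GJ eps12 scaleN1r opprK.
have [|defG blkG] := mxdiag_intertwine JG.
  apply: disjoint_intertwine disj _ => j; apply: H_skew_hankel_sim.
  by rewrite -leqNgt; apply: real.
have blk j : exists W : 'M_(bsize d j),
    [/\ submxblock G j j = sel (j < r)%N (block_mx 0 W (eps2 *: W ^t*) 0) W,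
        ut_skew_hankel_blocks W & ~~ (j < r)%N -> W ^t* = eps2 *: W].
  apply: H_skew_hankel_block epsK (nreal j) _ (blkG j) _.
    by rewrite -leqNgt; apply: real.
  by rewrite ctr_submxblock -/(ctrmx _) GH submxblockZ.
have [W {}blk] := dependent_choice blk.
exists W; split=> [|j|j le_rj].
- by rewrite {1}defG; apply: eq_mxdiag => j; case: (blk j).
- by case: (blk j).
by case: (blk j) => _ _; rewrite -leqNgt; apply.
Qed.

(** * The four structure classes and the values of [rho] *)

Theorem theorem3p3 (R : realType) (n k : nat) (n_ge1 : (1 <= n)%N)
    (k_ge2 : (2 <= k)%N) :
  [/\
  (forall (A : nat -> 'M[R]_n) (s r : nat) (m : 'I_s -> nat)
      (d : forall j, 'I_(m j) -> nat) (alpha beta : 'I_s -> R)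
      (X : 'M[R]_(n, \sum_(j < s) dim1 r j (bsize d j))),
    let Jb := J1 r d alpha beta in
    let J := \mxdiag_(j < s) Jb j in
    T_skew_symmetric k A -> A k \in unitmx ->
    (r <= s)%N ->
    (forall j, 0 < m j)%N -> (forall j t, 0 < d j t)%N ->
    (forall j : 'I_s, (j < r)%N -> beta j != 0) ->
    disjoint_spectra_real Jb ->
    standard_pair k A X J ->
    exists Gamma : 'M[R]_(\sum_(j < s) dim1 r j (bsize d j)),
      [/\ Gamma \in unitmx,
          in_S (@trmx R) (-1) (-1) J Gamma,
          represents (@trmx R) k A X J Gamma
        & exists U W : forall j, 'M[R]_(bsize d j),
          [/\ Gamma = \mxdiag_(j < s) Gamma1 r U W j,
              forall j, (U j)^T = - U j /\ ut_hankel_blocks (U j)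
            & forall j : 'I_s, (j < r)%N ->
                (W j)^T = - W j /\ ut_hankel_blocks (W j)]]),
  (forall (A : nat -> 'M[R]_n) (s r1 r2 : nat) (m : 'I_s -> nat)
      (d : forall j, 'I_(m j) -> nat) (alpha beta : 'I_s -> R)
      (X : 'M[R]_(n, \sum_(j < s) dim2 s r1 r2 j (bsize d j))),
    let Jb := J2 r1 r2 d alpha beta in
    let J := \mxdiag_(j < s) Jb j in
    T_odd k A -> A k \in unitmx ->
    (r1 <= r2 < s)%N ->
    (* m j = 0 is allowed for the last block, which is then absent *)
    (forall j : 'I_s, (j < s.-1)%N -> (0 < m j)%N) ->
    (forall j t, 0 < d j t)%N ->
    (forall j : 'I_s, (j < r1)%N -> alpha j != 0 /\ beta j != 0) ->
    (forall j : 'I_s, (r1 <= j < r2)%N -> beta j != 0) ->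
    (forall j : 'I_s, (r2 <= j < s.-1)%N -> alpha j != 0) ->
    disjoint_spectra_real Jb ->
    standard_pair k A X J ->
    exists Gamma : 'M[R]_(\sum_(j < s) dim2 s r1 r2 j (bsize d j)),
      [/\ Gamma \in unitmx,
          in_S (@trmx R) (-1) 1 J Gamma,
          represents (@trmx R) k A X J Gamma
        & exists U1 U2 W1 W2 V G : forall j, 'M[R]_(bsize d j),
          [/\ Gamma = \mxdiag_(j < s) Gamma2 r1 r2 U1 U2 W1 W2 V G j,
              forall j : 'I_s, (j < r1)%N ->
                ut_skew_hankel_blocks (U1 j) /\ ut_skew_hankel_blocks (U2 j),
              forall j : 'I_s, (r1 <= j < r2)%N ->
                [/\ (W1 j)^T = W1 j, ut_skew_hankel_blocks (W1 j),
                    (W2 j)^T = - W2 j & ut_skew_hankel_blocks (W2 j)],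
              forall j : 'I_s, (r2 <= j < s.-1)%N ->
                ut_skew_hankel_blocks (V j)
            & forall j : 'I_s, nat_of_ord j = s.-1 ->
                (G j)^T = G j /\ ut_skew_hankel_blocks (G j)]]),
  (forall (eps1 eps2 : R[i]) (A : nat -> 'M[R[i]]_n) (s r : nat)
      (m : 'I_s -> nat) (d : forall j, 'I_(m j) -> nat) (lambda : 'I_s -> R[i])
      (X : 'M[R[i]]_(n, \sum_(j < s) dim1 r j (bsize d j))),
    let Jb := J3 r d lambda in
    let J := \mxdiag_(j < s) Jb j in
    (eps1 = 1 \/ eps1 = -1) -> (eps2 = 1 \/ eps2 = -1) -> eps1 = eps2 ->
    structured (@ctrmx R) eps1 eps2 k A -> A k \in unitmx ->
    (r <= s)%N ->
    (forall j, 0 < m j)%N -> (forall j t, 0 < d j t)%N ->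
    (forall j : 'I_s, (j < r)%N -> lambda j \isn't Num.real) ->
    (forall j : 'I_s, (r <= j)%N -> lambda j \is Num.real) ->
    disjoint_spectra Jb ->
    standard_pair k A X J ->
    exists Gamma : 'M[R[i]]_(\sum_(j < s) dim1 r j (bsize d j)),
      [/\ Gamma \in unitmx,
          in_S (@ctrmx R) eps1 eps2 J Gamma,
          represents (@ctrmx R) k A X J Gamma
        & exists (rho : R[i]) (W : forall j, 'M[R[i]]_(bsize d j)),
          [/\ Gamma = \mxdiag_(j < s) Gamma34 r rho W j,
              forall j, ut_hankel_blocks (W j),
              H_hermitian k A -> rho = 1 /\
                (forall j : 'I_s, (r <= j)%N -> (W j) ^t* = W j)
            & H_skew_hermitian k A -> rho = -1 /\
                (forall j : 'I_s, (r <= j)%N -> (W j) ^t* = - W j)]])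
  & (forall (eps1 eps2 : R[i]) (A : nat -> 'M[R[i]]_n) (s r : nat)
      (m : 'I_s -> nat) (d : forall j, 'I_(m j) -> nat) (lambda : 'I_s -> R[i])
      (X : 'M[R[i]]_(n, \sum_(j < s) dim1 r j (bsize d j))),
    let Jb := J4 r d lambda in
    let J := \mxdiag_(j < s) Jb j in
    (eps1 = 1 \/ eps1 = -1) -> (eps2 = 1 \/ eps2 = -1) -> eps1 <> eps2 ->
    structured (@ctrmx R) eps1 eps2 k A -> A k \in unitmx ->
    (r <= s)%N ->
    (forall j, 0 < m j)%N -> (forall j t, 0 < d j t)%N ->
    (forall j : 'I_s, (j < r)%N -> 'Re (lambda j) != 0) ->
    (forall j : 'I_s, (r <= j)%N -> 'Re (lambda j) = 0) ->
    disjoint_spectra Jb ->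
    standard_pair k A X J ->
    exists Gamma : 'M[R[i]]_(\sum_(j < s) dim1 r j (bsize d j)),
      [/\ Gamma \in unitmx,
          in_S (@ctrmx R) eps1 eps2 J Gamma,
          represents (@ctrmx R) k A X J Gamma
        & exists (rho : R[i]) (V : forall j, 'M[R[i]]_(bsize d j)),
          [/\ Gamma = \mxdiag_(j < s) Gamma34 r rho V j,
              forall j, ut_skew_hankel_blocks (V j),
              H_odd k A -> rho = 1 /\
                (forall j : 'I_s, (r <= j)%N -> (V j) ^t* = V j)
            & H_even k A -> rho = -1 /\
                (forall j : 'I_s, (r <= j)%N -> (V j) ^t* = - V j)]])].
Proof.
split.
- move=> A s r m d alpha beta X Jb J AT Aku _ _ _.
  exact: T_skew_Gamma.
- move=> A s r1 r2 m d alpha beta X Jb J AT Aku r12s _ _.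
  exact: T_odd_Gamma.
- move=> eps1 eps2 A s r m d lambda X Jb J sgn1 sgn2 eq_eps AH Aku _ _ _ nreal real.
  move=> disj XJ.
  have [G [Gu GS Grep [W [defG hW WH]]]] :=
    H_hankel_Gamma k_ge2 sgn1 sgn2 eq_eps AH Aku nreal real disj XJ.
  exists G; split=> //; exists eps2, W; split=> // AH'.
    (* Both structures have equal signs, so the sign of the leading coefficient determines [eps2]
       whatever the parity of [k]. *)
    have := structured_sign n_ge1 Aku AH AH'; rewrite eq_eps !if_same => eps2E.
    by split=> // j le_rj; rewrite WH // eps2E scale1r.
  have := structured_sign n_ge1 Aku AH AH'; rewrite eq_eps !if_same => eps2E.
  by split=> // j le_rj; rewrite WH // eps2E scaleN1r.
move=> eps1 eps2 A s r m d lambda X Jb J sgn1 sgn2 neq_eps AH Aku _ _ _ nreal real.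
move=> disj XJ.
have [G [Gu GS Grep [W [defG hW WH]]]] :=
  H_skew_hankel_Gamma k_ge2 sgn1 sgn2 neq_eps AH Aku nreal real disj XJ.
exists G; split=> //; exists eps2, W; split=> // AH'.
  (* For odd [k] the leading coefficient gives [eps2] directly; for even [k] it gives [eps1], and
     [eps2] is the other sign. *)
  have eps2E : eps2 = 1.
    have := structured_sign n_ge1 Aku AH AH'; case: odd => // eps1E.
    by case: sgn2 => // eps2E; case: neq_eps; rewrite eps1E.
  by split=> // j le_rj; rewrite WH // eps2E scale1r.
have eps2E : eps2 = -1.
  have := structured_sign n_ge1 Aku AH AH'; case: odd => // eps1E.
  by case: sgn2 => // eps2E; case: neq_eps; rewrite eps1E.
by split=> // j le_rj; rewrite WH // eps2E scaleN1r.
Qed.
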